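(* Let $\ell\in\mathbb N$. Let $\mathbf p$ be an offspring distribution with $\mathbf p(0)+\mathbf p(1)<1$, with finite mean, and admitting a moment of order $\ell$, and let $\mathbf q$ be a mark function such that $\mathbf p(k)\mathbf q(k)>0$ for some $k\in\mathbb N$. Let $\mathbb P$ be the distribution of the marked Galton-Watson tree with offspring distribution $\mathbf p$ and mark function $\mathbf q$. Let $r=\min\{k\in\mathbb N:\mathbf p(k)>0\}$. Let $s\in(0,1)$, let $\kappa(s)$ be the unique fixed point in $[0,1]$ of the function $f_s(t)=\mathbb E[s^{M_1}t^{Z_1}]$, and let $\alpha_r(s)=\mathbf p(r)(s\mathbf q(r)+1-\mathbf q(r))$. Then for every $n\in\mathbb N$ and $\Lambda_n\in\mathscr F_n$: (i) If $r=0$, then for every $t\in[0,1]$, $$\lim_{p\to+\infty}\frac{\mathbb E[\mathbf 1_{\Lambda_n}H_\ell(Z_{n+p})s^{M_{n+p}}t^{Z_{n+p}}]}{\mathbb E[H_\ell(Z_{n+p})s^{M_{n+p}}t^{Z_{n+p}}]}=\begin{cases}\mathbb E\left[\mathbf 1_{\Lambda_n}s^{M_n}\kappa(s)^{Z_n-1}\right]&\text{if }\ell=0,\\[1mm] \mathbb E\left[\mathbf 1_{\Lambda_n}\dfrac{s^{M_n}Z_n\kappa(s)^{Z_n-1}}{f_s'(\kappa(s))^n}\right]&\text{if }\ell>0.\end{cases}$$ (ii) If $r=1$, then for every $t\in(0,1]$, $$\lim_{p\to+\infty}\frac{\mathbb E[\mathbf 1_{\Lambda_n}H_\ell(Z_{n+p})s^{M_{n+p}}t^{Z_{n+p}}]}{\mathbb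 E[H_\ell(Z_{n+p})s^{M_{n+p}}t^{Z_{n+p}}]}=\mathbb E\left[\mathbf 1_{\Lambda_n}s^{M_n}\alpha_1(s)^{-n}\mathbf 1_{Z_n=1}\right].$$ (iii) If $r\ge2$, then for every $t\in(0,1]$, $$\lim_{p\to+\infty}\frac{\mathbb E[\mathbf 1_{\Lambda_n}H_\ell(Z_{n+p})s^{M_{n+p}}t^{Z_{n+p}}]}{\mathbb E[H_\ell(Z_{n+p})s^{M_{n+p}}t^{Z_{n+p}}]}=\mathbb E\left[\mathbf 1_{\Lambda_n}s^{M_n}\alpha_r(s)^{-\frac{r^n-1}{r-1}}\mathbf 1_{Z_n=r^n}\right].$$
   Context: $\mathbb N=\{0,1,2,\dots\}$, $\mathbb N^*=\{1,2,\dots\}$. Let $\mathscr U=\bigcup_{n\ge0}(\mathbb N^* )^n$ be the set of finite sequences of positive integers, $|u|$ the length of $u$, $\emptyset$ the empty sequence. A tree $\mathbf t$ is a subset of $\mathscr U$ such that $\emptyset\in\mathbf t$; $uj\in\mathbf t\Rightarrow u\in\mathbf t$ (for $j\in\mathbb N^*$); and for each $u\in\mathbf t$ there is $k_u(\mathbf t)\in\mathbb N$ with $ui\in\mathbf t\iff i\le k_u(\mathbf t)$. A marked tree is $\mathbf t^*=(\mathbf t,(\eta_u)_{u\in\mathbf t})$ with $\eta_u\in\{0,1\}$; $\mathbb T^*$ is the set of marked trees. For $n\in\mathbb N$, $r_n^*(\mathbf t^* )$ is the marked tree consisting of the nodes $u\in\mathbf t$ with $|u|\le n$, keeping the marks of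 nodes with $|u|\le n-1$ and setting the marks at level $n$ to $0$. $\mathscr F_n$ is the $\sigma$-field on $\mathbb T^*$ generated by $r_n^*$, and $\mathscr F=\bigvee_n\mathscr F_n$. $Z_n(\mathbf t^* )$ is the number of nodes $u\in\mathbf t$ with $|u|=n$; $M_0=0$ and $M_n(\mathbf t^* )=\sum_{u\in\mathbf t,|u|\le n-1}\eta_u$ for $n\ge1$. An offspring distribution is a probability distribution $\mathbf p$ on $\mathbb N$; a mark function is a map $\mathbf q:\mathbb N\to[0,1]$. Set $\mathbf p_0(k,1)=\mathbf p(k)\mathbf q(k)$, $\mathbf p_0(k,0)=\mathbf p(k)(1-\mathbf q(k))$. The marked Galton-Watson tree distribution $\mathbb P$ is the unique probability measure on $(\mathbb T^*,\mathscr F)$ such that, with $\tau^*$ the identity map of $\mathbb T^*$, for all $h\ge1$ and $\mathbf t^*\in\mathbb T^*$, $\mathbb P(r_h^*(\tau^* )=r_h^*(\mathbf t^* ))=\prod_{u\in\mathbf t,|u|\le h-1}\mathbf p_0(k_u(\mathbf t),\eta_u)$. $\mathbb E$ is the expectation under $\mathbb P$, and $Z_n=Z_n(\tau^* )$, $M_n=M_n(\tau^* )$. $H_\ell$ is the $\ell$-th Hilbert polynomial: $H_0(x)=1$, $H_\ell(x)=\frac1{\ell!}\prod_{j=0}^{\ell-1}(x-j)$ for $\ell\ge1$. Convention $0^0=1$. The derivative $f_s'$ is with respect to $t$.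
   Formalization: In (i), the case t = 0 with ℓ > 0 is excluded: there H_ℓ(Z)·0^Z is always 0, so the ratio is 0/0 for every p; t = 0 is kept for ℓ = 0. *)

(* Defs.v *)
From HB Require Import structures.
From mathcomp Require Import all_boot all_order all_algebra finmap.
From mathcomp Require Import all_classical all_reals all_analysis.

Set Implicit Arguments.
Unset Strict Implicit.
Unset Printing Implicit Defensive.

Import Order.TTheory GRing.Theory Num.Theory.
Import numFieldNormedType.Exports.

Local Open Scope classical_set_scope.
Local Open Scope ring_scope.

(* Nodes are words of positive integers; [rcons u j] is the node written uj. *)
Record tree := Tree {
  nodes : set (seq nat);
  nodes_pos : forall u, nodes u -> all (fun j => 0 < j)%N u;
  nodes_root : nodes [::];
  nodes_parent : forall u j, nodes (rcons u j) -> nodes u;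
  nodes_children : forall u, nodes u -> exists k : nat,
    forall i, (0 < i)%N -> (nodes (rcons u i) <-> (i <= k)%N) }.

(* The number k_u(t); the value is irrelevant when u is not a node of t. *)
Definition nchildren (t : tree) (u : seq nat) : nat :=
  xget 0%N [set k | forall i, (0 < i)%N -> (nodes t (rcons u i) <-> (i <= k)%N)].

(* Marks are extended by [false] outside the tree, so that a marked tree is
   determined by its nodes and the marks on them. *)
Record mtree := MTree {
  mtree_tree :> tree;
  mark : seq nat -> bool;
  mark_node : forall u, mark u -> nodes mtree_tree u }.

Section restriction.
Variable n : nat.

Definition restr_nodes (t : tree) : set (seq nat) :=
  [set u | nodes t u /\ (size u <= n)%N].

Lemma restr_nodes_pos t u :
  restr_nodes t u -> all (fun j => 0 < j)%N u.
Proof. by move=> [/nodes_pos]. Qed.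

Lemma restr_nodes_root t : restr_nodes t [::].
Proof. by split => //; exact: nodes_root. Qed.

Lemma restr_nodes_parent t u j :
  restr_nodes t (rcons u j) -> restr_nodes t u.
Proof.
by move=> [/nodes_parent tu]; rewrite size_rcons => /ltnW.
Qed.

Lemma restr_nodes_children t u : restr_nodes t u -> exists k : nat,
  forall i, (0 < i)%N -> (restr_nodes t (rcons u i) <-> (i <= k)%N).
Proof.
move=> [tu _]; have [k kP] := nodes_children tu.
exists (if (size u < n)%N then k else 0%N) => i i0.
rewrite /restr_nodes /= size_rcons; case: ifPn => un.
  by split=> [[/(kP _ i0)]|/(kP _ i0)].
by rewrite leqn0 -[i == _]negbK -lt0n i0; split=> // -[].
Qed.

Definition restr_tree (t : tree) : tree :=
  Tree (@restr_nodes_pos t) (restr_nodes_root t)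
    (@restr_nodes_parent t) (@restr_nodes_children t).

Definition restr_mark (t : mtree) (u : seq nat) : bool :=
  mark t u && (size u < n)%N.

Lemma restr_mark_node (t : mtree) u : restr_mark t u -> nodes (restr_tree t) u.
Proof. by move=> /andP[/mark_node tu /ltnW]. Qed.

(* The map r_n^*. *)
Definition restr (t : mtree) : mtree := MTree (@restr_mark_node t).

End restriction.

Section root_tree.

Let root_nodes : set (seq nat) := [set [::]].

Let root_nodes_pos u : root_nodes u -> all (fun j => 0 < j)%N u.
Proof. by move=> ->. Qed.

Let root_nodes_parent u j : root_nodes (rcons u j) -> root_nodes u.
Proof. by case: u. Qed.

Let root_nodes_children u : root_nodes u -> exists k : nat,
  forall i, (0 < i)%N -> (root_nodes (rcons u i) <-> (i <= k)%N).
Proof. by move=> ->; exists 0%N => -[|i]. Qed.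

Definition root_tree : tree :=
  Tree root_nodes_pos erefl root_nodes_parent root_nodes_children.

Let no_mark (u : seq nat) : bool := false.

Let no_mark_node u : no_mark u -> nodes root_tree u. Proof. by []. Qed.

Definition root_mtree : mtree := MTree no_mark_node.

End root_tree.

HB.instance Definition _ := gen_eqMixin mtree.
HB.instance Definition _ := gen_choiceMixin mtree.
HB.instance Definition _ := isPointed.Build mtree root_mtree.

(* r_n^* takes countably many values, and its range carries the discrete
   sigma-field: F_n consists of the preimages of arbitrary sets. *)
Definition Fn (n : nat) : set (set mtree) :=
  preimage_set_system setT (restr n) setT.

(* T^* equipped with the sigma-field F generated by all the F_n. *)
Definition mtreeF := g_sigma_algebraType (\bigcup_n Fn n).

Lemma nchildrenP (t : tree) u i : nodes t u -> (0 < i)%N ->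
  nodes t (rcons u i) <-> (i <= nchildren t u)%N.
Proof.
by move=> /nodes_children tu i0; rewrite /nchildren; exact: (xgetPex 0%N tu).
Qed.

(* Hence the cardinals and the finitely supported big operators over such sets
   below never take their default value. *)
Lemma finite_level (t : tree) n :
  finite_set [set u | nodes t u /\ size u = n].
Proof.
elim: n => [|n IH].
  by apply: (sub_finite_set _ (finite_set1 [::])) => u [_ /size0nil].
pose F u := rcons u @` `I_(nchildren t u).+1.
apply: (@sub_finite_set _ _ (\bigcup_(u in [set u | nodes t u /\ size u = n]) F u)).
  move=> u [/=]; case/lastP: u => // u i tui; rewrite size_rcons => -[un].
  have tu := nodes_parent tui; exists u => //; exists i => //=.
  have /= := nodes_pos tui; rewrite all_rcons => /andP[i0 _].
  by rewrite ltnS; apply/nchildrenP.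
by apply: bigcup_finite => // u _; exact/finite_image/finite_II.
Qed.

Lemma finite_below (t : tree) n :
  finite_set [set u | nodes t u /\ (size u < n)%N].
Proof.
apply: (@sub_finite_set _ _
    (\bigcup_(m in `I_n) [set u | nodes t u /\ size u = m])).
  by move=> u [tu un]; exists (size u).
by apply: bigcup_finite => [|m _]; [exact: finite_II|exact: finite_level].
Qed.

Definition Zn (n : nat) (t : mtree) : nat :=
  #|` fset_set [set u | nodes t u /\ size u = n] |%fset.

Definition Mn (n : nat) (t : mtree) : nat :=
  \big[addn/0%N]_(u \in [set u | nodes t u /\ (size u < n)%N])
    nat_of_bool (mark t u).

Section marked_GW.
Variable R : realType.
Implicit Types p q : nat -> R.

Definition offspring_distribution p :=
  (forall k, 0 <= p k) /\ (\sum_(0 <= k <oo) (p k)%:E = 1)%E.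

Definition has_moment p (l : nat) :=
  (\sum_(0 <= k <oo) (k%:R ^+ l * p k)%:E < +oo)%E.

Definition mark_function q := forall k, 0 <= q k <= 1.

Definition p0 p q (k : nat) (eta : bool) : R :=
  p k * (if eta then q k else 1 - q k).

Definition marked_GW p q (P : probability mtreeF R) :=
  forall (h : nat) (t : mtree), (0 < h)%N ->
    P [set x : mtreeF | restr h x = restr h t] =
    (\big[*%R/1]_(u \in [set u | nodes t u /\ (size u < h)%N])
       p0 p q (nchildren t u) (mark t u))%:E.

Definition hilbert (l : nat) : {poly R} :=
  (l`!%:R)^-1 *: \prod_(j < l) ('X - (j%:R)%:P).

Definition Ex (P : probability mtreeF R) (X : mtreeF -> R) : R :=
  fine ('E_P[X])%E.

Definition gen_fun (P : probability mtreeF R) (s t : R) : R :=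
  Ex P (fun x => s ^+ Mn 1 x * t ^+ Zn 1 x).

Definition alpha p q (r : nat) (s : R) : R := p r * (s * q r + 1 - q r).

Definition GW_ratio (P : probability mtreeF R) (l : nat) (s t : R)
    (n : nat) (Lambda : set mtree) (m : nat) : R :=
  Ex P (fun x => \1_Lambda x *
    ((hilbert l).[(Zn (n + m) x)%:R] * s ^+ Mn (n + m) x * t ^+ Zn (n + m) x))
  / Ex P (fun x =>
      (hilbert l).[(Zn (n + m) x)%:R] * s ^+ Mn (n + m) x * t ^+ Zn (n + m) x).

End marked_GW.

(* Main.v *)
(* Put a_k = alpha p q k s and f(x) = \sum_k a_k x^k. By the branching property,
   E[1_Lambda s^M_{n+m} x^Z_{n+m}] = E[1_Lambda s^M_n (f^m x)^Z_n] for Lambda in F_n, where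
   f^m is the m-th iterate of f. Evaluating at x = t(1 + eps) and reading off the coefficient
   of eps^l turns x^Z into H_l(Z) t^Z, and replaces f^m x by the truncated power series X_m
   obtained by iterating f on t(1 + eps). Hence the ratio is
   E[1_Lambda s^M_n W_m(Z_n)] / E[s^M_n W_m(Z_n)] with W_m(k) = [eps^l] X_m^k, and it suffices
   to find norming constants such that W_m(k) / norm_m is bounded and converges to some v(k):
   dominated convergence applies, and E[s^M_n v(Z_n)] is computed from the branching property.
   - r = 0, l = 0: f^m t tends to kappa because f contracts distances to kappa, by convexity.
   - r = 0, l > 0, norm_m = [eps^l] X_m: the coefficients of X_m of positive index are all of
     the order of [eps^1] X_m, which decays geometrically, so only the term linear in them
     survives and v(k) = k kappa^(k-1).
   - r > 0, norm_m = W_m(r^n): X_m / f^m t has coefficients of order at most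
     \prod_{i<m} r (1 + O(f^i t)), which f^m t beats, so v(k) = 1_{k = r^n}, while
     Z_n >= r^n almost surely. *)

Require Import Defs.
From HB Require Import structures.
From mathcomp Require Import all_boot all_order all_algebra finmap.
From mathcomp Require Import all_classical all_reals all_analysis.
From mathcomp Require Import measurable_realfun.
From mathcomp Require Import ring lra zify.

Import Order.TTheory GRing.Theory Num.Theory.
Import numFieldNormedType.Exports.

Local Open Scope classical_set_scope.
Local Open Scope ring_scope.

Set Implicit Arguments.
Unset Strict Implicit.
Unset Printing Implicit Defensive.

(** * Marked trees and their restrictions *)

(** Jets replace l-fold differentiation because t = 1 is allowed while only l moments are given, so
    derivatives of the iterates might be wanted at the boundary of the domain of convergence. Each
    coefficient of X_m is a convergent sum of nonnegative terms, and all estimates compare such sums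
    term by term. The law is known only through the probabilities of atoms, so independence of the
    subtrees is not at hand. The branching property is rebuilt inside an atom of F_n by exposing the
    nodes of level n one after the other, each exposure being one application of an averaging
    operator; the countably many atoms are then summed. The inequality f(1) < 1, due to s < 1 and
    some p(k)q(k) > 0, is what makes things decay. For r = 0 it gives chords of f ending at 1 a
    slope below 1, which bounds f' by convexity. For r = 1, where x^(r-1) brings no smallness, the
    factor f(1) alone makes the terms with Z_n > r^n disappear. *)

Lemma mtree_eq (x y : mtree) : nodes x = nodes y -> mark x = mark y -> x = y.
Proof.
case: x => -[N1 a1 b1 c1 d1] m1 e1; case: y => -[N2 a2 b2 c2 d2] m2 e2 /= eN em.
subst N2 m2.
rewrite (Prop_irrelevance a2 a1) (Prop_irrelevance b2 b1).
rewrite (Prop_irrelevance c2 c1) in e2 *.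
by rewrite (Prop_irrelevance d2 d1) (Prop_irrelevance e2 e1).
Qed.

Lemma restr_eqP n (x y : mtree) : restr n x = restr n y <->
  (forall u, (size u <= n)%N -> (nodes x u <-> nodes y u)) /\
  (forall u, (size u < n)%N -> mark x u = mark y u).
Proof.
split=> [exy|[eN em]].
  split=> u un.
    have := congr1 (fun z : mtree => nodes z u) exy.
    rewrite /= /restr_nodes /= => /propeqP[h1 h2].
    by split=> ?; [case: h1|case: h2].
  by have := congr1 (fun z : mtree => mark z u) exy; rewrite /= /restr_mark un !andbT.
apply: mtree_eq; apply/funext => u /=.
  by apply/propeqP; rewrite /restr_nodes /=; split=> -[xu un]; split=> //; apply/eN.
by rewrite /restr_mark; case: ltnP => un; rewrite ?andbF// !andbT em.
Qed.

Lemma restr_le n k (x y : mtree) : (n <= k)%N ->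
  restr k x = restr k y -> restr n x = restr n y.
Proof.
move=> nk /restr_eqP[eN em]; apply/restr_eqP.
by split=> u un; [apply: eN; exact: leq_trans un nk|apply: em; exact: leq_trans un nk].
Qed.

Lemma nchildren_unique (t : tree) u k : nodes t u ->
  (forall i, (0 < i)%N -> (nodes t (rcons u i) <-> (i <= k)%N)) ->
  nchildren t u = k.
Proof.
move=> tu hk; have h i : (0 < i)%N -> (i <= nchildren t u)%N = (i <= k)%N.
  by move=> i0; apply/idP/idP => [/(nchildrenP tu i0) /hk -/(_ i0)|
    /hk -/(_ i0) /(nchildrenP tu i0)].
apply/eqP; rewrite eqn_leq; apply/andP; split.
  by case E : (nchildren t u) => [//|j]; rewrite -h ?E.
by case: k hk h => [//|j] hk h; rewrite h.
Qed.

Lemma restr_nchildren n (x y : mtree) u : restr n x = restr n y ->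
  nodes x u -> (size u < n)%N -> nchildren x u = nchildren y u.
Proof.
move=> /restr_eqP[eN _] xu un.
apply: nchildren_unique => // i i0.
have yu : nodes y u by apply/eN => //; exact: ltnW.
have su : (size (rcons u i) <= n)%N by rewrite size_rcons.
exact: (iff_trans (eN _ su) (nchildrenP yu i0)).
Qed.

Definition level (n : nat) (t : mtree) : seq (seq nat) :=
  enum_fset (fset_set [set u | nodes t u /\ size u = n]).

Lemma mem_level n (t : mtree) u : u \in level n t <-> nodes t u /\ size u = n.
Proof.
rewrite /level -/(mem _ _); rewrite (_ : (u \in _) = (u \in
  [set u | nodes t u /\ size u = n])); last exact: (in_fset_set (finite_level t n)).
by rewrite inE.
Qed.

Lemma uniq_level n t : uniq (level n t). Proof. exact: fset_uniq. Qed.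

Lemma Zn_level n t : Zn n t = size (level n t). Proof. by []. Qed.

Lemma restr_level n (x y : mtree) : restr n x = restr n y -> level n x = level n y.
Proof.
move=> /restr_eqP[eN _]; rewrite /level; congr (enum_fset (fset_set _)).
apply/seteqP; split => u [xu un]; split=> //.
  by apply/eN => //; rewrite un.
by apply/eN => //; rewrite un.
Qed.

Lemma restr_Zn n (x y : mtree) : restr n x = restr n y -> Zn n x = Zn n y.
Proof. by move=> exy; rewrite !Zn_level (restr_level exy). Qed.

Lemma restr_Mn n (x y : mtree) : restr n x = restr n y -> Mn n x = Mn n y.
Proof.
move=> /restr_eqP[eN em]; rewrite /Mn.
rewrite (_ : [set u | nodes y u /\ _] = [set u | nodes x u /\ (size u < n)%N]).
  by apply: eq_fsbigr => u; rewrite inE /= => -[_ un]; rewrite em.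
by apply/seteqP; split => u [xu un]; split=> //; apply/eN => //; exact: ltnW.
Qed.

Lemma fsbig_belowS (R : Type) (idx : R) (op : Monoid.com_law idx) n (t : mtree)
    (F : seq nat -> R) :
  \big[op/idx]_(u \in [set u | nodes t u /\ (size u < n.+1)%N]) F u =
  op (\big[op/idx]_(u \in [set u | nodes t u /\ (size u < n)%N]) F u)
     (\big[op/idx]_(u <- level n t) F u).
Proof.
rewrite (_ : [set u | nodes t u /\ (size u < n.+1)%N] =
  [set u | nodes t u /\ (size u < n)%N] `|` [set u | nodes t u /\ size u = n]).
  rewrite fsbigU0.
  - by congr (op _ _); rewrite fsbig_finite//; exact: finite_level.
  - exact: finite_below.
  - exact: finite_level.
  - by move=> u [[_ +] [_ un]] /=; rewrite un ltnn.
apply/seteqP; split => u /=.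
  by rewrite ltnS leq_eqVlt => -[tu /orP[/eqP|] un]; [right|left].
by move=> [[tu un]|[tu un]]; split=> //; rewrite ?un// ltnS ltnW.
Qed.

Lemma MnS n t : Mn n.+1 t = (Mn n t + \sum_(u <- level n t) mark t u)%N.
Proof. by rewrite /Mn fsbig_belowS. Qed.

Lemma ZnS n t : Zn n.+1 t = (\sum_(u <- level n t) nchildren t u)%N.
Proof.
rewrite Zn_level.
pose s := [seq rcons u i | u <- level n t, i <- iota 1 (nchildren t u)].
have -> : size (level n.+1 t) = size s.
  apply: perm_size; apply: uniq_perm; first exact: uniq_level.
    apply: allpairs_uniq_dep => [|u _|]; [exact: uniq_level|exact: iota_uniq|].
    move=> [u i] [v j] _ _ /= /eqP; rewrite eqseq_rcons => /andP[/eqP -> /eqP ->] //.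
  move=> v; apply/idP/allpairsPdep => [/mem_level[tv]|[u [i [/mem_level[tu un]]]]].
    case/lastP: v tv => // u i tui; rewrite size_rcons => -[un].
    exists u, i; split => //; first by apply/mem_level; split=> //; exact: nodes_parent tui.
    have /= := nodes_pos tui; rewrite all_rcons => /andP[i0 _].
    by rewrite mem_iota i0 add1n ltnS; apply/(nchildrenP (nodes_parent tui)).
  rewrite mem_iota add1n ltnS => /andP[i0 ik] ->; apply/mem_level.
  by split; [apply/nchildrenP|rewrite size_rcons un].
rewrite size_allpairs_dep sumnE big_map; apply: eq_bigr => u _.
by rewrite size_iota.
Qed.

Lemma Zn0 t : Zn 0 t = 1%N.
Proof.
rewrite Zn_level; suff : perm_eq (level 0 t) [:: [::]] by move=> /perm_size.
apply: uniq_perm; [exact: uniq_level|by []|] => u.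
rewrite inE; apply/idP/eqP => [/mem_level[_ /size0nil]//|->].
by apply/mem_level; split=> //; exact: nodes_root.
Qed.

Lemma Mn0 t : Mn 0 t = 0%N.
Proof. by rewrite /Mn (_ : [set u | _] = set0) ?fsbig_set0//; apply/seteqP; split => u // []. Qed.

(* Every prescription of the numbers of children [K] and of the marks [E] of the nodes of [t]
   at level [n] is realized by a tree, so that [marked_GW] applies to it. *)
Section extension.
Variables (t : mtree) (n : nat) (K : seq nat -> nat) (E : seq nat -> bool).

Definition ext_nodes : set (seq nat) := [set v |
  (nodes t v /\ (size v <= n)%N) \/
  exists u i, [/\ v = rcons u i, nodes t u, size u = n & (0 < i <= K u)%N]].

Lemma ext_nodes_pos u : ext_nodes u -> all (fun j => 0 < j)%N u.
Proof.
move=> [[/nodes_pos//]|[v [i [-> tv _ /andP[i0 _]]]]].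
by rewrite all_rcons i0; exact: nodes_pos tv.
Qed.

Lemma ext_nodes_root : ext_nodes [::].
Proof. by left; split=> //; exact: nodes_root. Qed.

Lemma ext_nodes_parent u j : ext_nodes (rcons u j) -> ext_nodes u.
Proof.
move=> [[/nodes_parent tu]|[v [i [/rcons_inj[-> _] tv vn _]]]].
  by rewrite size_rcons => /ltnW un; left.
by left; rewrite vn.
Qed.

Lemma ext_nodes_low u i : (size u < n)%N ->
  ext_nodes (rcons u i) <-> nodes t (rcons u i).
Proof.
move=> un; split=> [[[]//|[v [j [/rcons_inj[<- _] _ vn _]]]]|tui].
  by rewrite vn ltnn in un.
by left; rewrite size_rcons.
Qed.

Lemma ext_nodes_top u i : nodes t u -> size u = n -> (0 < i)%N ->
  ext_nodes (rcons u i) <-> (i <= K u)%N.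
Proof.
move=> tu un i0; split=> [[[_]|[v [j [/rcons_inj[-> ->] _ _ /andP[]//]]]]|iK].
  by rewrite size_rcons un ltnn.
by right; exists u, i; rewrite i0.
Qed.

Lemma ext_nodes_children u : ext_nodes u -> exists k : nat,
  forall i, (0 < i)%N -> (ext_nodes (rcons u i) <-> (i <= k)%N).
Proof.
move=> eu; have [un|un|un] := ltngtP (size u) n.
- have tu : nodes t u by case: eu => [[]//|[v [i [e _ vn _]]]]; move: un;
    rewrite e size_rcons vn ltnNge leqnSn.
  exists (nchildren t u) => i i0.
  exact: (iff_trans (ext_nodes_low i un) (nchildrenP tu i0)).
- exists 0%N => i i0; split=> [[[_]|[v [j [/rcons_inj[<- _] _ vn _]]]]|].
  + by rewrite size_rcons leqNgt ltnS ltnW.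
  + by rewrite vn ltnn in un.
  + by rewrite leqNgt i0.
- have tu : nodes t u by case: eu => [[]//|[v [i [e _ vn _]]]]; move: un;
    rewrite e size_rcons vn => /eqP; rewrite eqn_leq ltnn.
  by exists (K u) => i i0; exact: ext_nodes_top.
Qed.

Definition ext_tree : tree := Tree ext_nodes_pos ext_nodes_root
  ext_nodes_parent ext_nodes_children.

Definition ext_mark u := (mark t u && (size u < n)%N) ||
  [&& u \in level n t & E u].

Lemma ext_mark_node u : ext_mark u -> nodes ext_tree u.
Proof.
case/orP => [/andP[/mark_node tu /ltnW]|/andP[/mem_level[tu un] _]]; left => //.
by rewrite un.
Qed.

Definition ext_mtree : mtree := MTree ext_mark_node.

Lemma ext_nodesE u : (size u <= n)%N -> nodes ext_mtree u <-> nodes t u.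
Proof.
move=> un; split => [[[]//|[v [i [e _ vn _]]]]|tu]; last by left.
by move: un; rewrite e size_rcons vn ltnn.
Qed.

Lemma ext_level : level n ext_mtree = level n t.
Proof.
rewrite /level; congr (enum_fset (fset_set _)); apply/seteqP.
by split => u [xu un]; split=> //; apply/ext_nodesE => //; rewrite un.
Qed.

Lemma ext_markE u : (size u < n)%N -> mark ext_mtree u = mark t u.
Proof.
move=> un; rewrite /= /ext_mark un andbT.
case: (boolP (u \in _)) => [/mem_level[_ e]|]; last by rewrite /= orbF.
by rewrite e ltnn in un.
Qed.

Lemma restr_ext : restr n ext_mtree = restr n t.
Proof. by apply/restr_eqP; split => u un; [exact: ext_nodesE|exact: ext_markE]. Qed.

Lemma nchildren_ext u : u \in level n t -> nchildren ext_mtree u = K u.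
Proof.
move=> /mem_level[tu un]; apply: nchildren_unique.
  by apply/ext_nodesE => //; rewrite un.
by move=> i i0; exact: ext_nodes_top.
Qed.

Lemma mark_ext u : u \in level n t -> mark ext_mtree u = E u.
Proof. by move=> tu; rewrite /= /ext_mark tu; move/mem_level: tu => [_ ->]; rewrite ltnn andbF. Qed.

Lemma restrS_ext x : restr n.+1 x = restr n.+1 ext_mtree <->
  restr n x = restr n t /\
  forall u, u \in level n t -> nchildren x u = K u /\ mark x u = E u.
Proof.
split=> [e|[e h]].
  have e' := restr_le (leqnSn n) e; split; first by rewrite e' restr_ext.
  move=> u tu; have [tu' un] := (mem_level _ _ _).1 tu.
  rewrite -(nchildren_ext tu) -(mark_ext tu); split.
    apply: (restr_nchildren e); last by rewrite un.
    by move/restr_eqP : e' => [eN _]; apply/eN; [rewrite un|apply/ext_nodesE => //; rewrite un].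
  by move/restr_eqP : e => [_ ->//]; rewrite un.
have [eN em] := (restr_eqP _ _ _).1 e.
apply/restr_eqP; split=> u.
  rewrite leq_eqVlt ltnS => /orP[/eqP|un]; last first.
    by apply: (iff_trans (eN _ un)); apply: iff_sym; exact: ext_nodesE.
  case/lastP: u => // u i; rewrite size_rcons => -[un].
  have sun : (size u <= n)%N by rewrite un.
  have [tu|tu] := pselect (nodes t u); last first.
    split=> /nodes_parent => [/(eN _ sun)//|/(ext_nodesE sun)//].
  have [->|] := posnP i.
    by split=> /nodes_pos; rewrite all_rcons.
  move=> i0; have lu : u \in level n t by apply/mem_level.
  apply: iff_trans (iff_sym (ext_nodes_top tu un i0)).
  by rewrite -(h _ lu).1; apply: nchildrenP => //; apply/eN.
rewrite ltnS leq_eqVlt => /orP[/eqP|] un; last by rewrite em// ext_markE.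
have [lu|lu] := boolP (u \in level n t); first by rewrite (h _ lu).2 mark_ext.
have ntu : ~ nodes t u by move=> tu; move/negP: lu; apply; apply/mem_level.
have sun : (size u <= n)%N by rewrite un.
transitivity false; first by apply/negP => /mark_node /(eN _ sun).
by apply/esym/negP => /mark_node /(ext_nodesE sun).
Qed.

End extension.

(* A numbering of the atoms of [Fn n]. *)
Definition code (n : nat) (x : mtree) : nat :=
  @choice.pickle ({fset seq nat} * {fset seq nat})%type
    (fset_set (nodes (restr n x)), fset_set [set u | mark (restr n x) u]).

(** A truncated tree is finite, so the pair of its finite sets of nodes and of marked nodes
    determines it and can be encoded by an integer. *)
Lemma code_eq n (x y : mtree) : code n x = code n y <-> restr n x = restr n y.
Proof.
split=> [/(pcan_inj choice.pickleK)[e1 e2]|e]; last by rewrite /code e.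
have fN (z : mtree) : finite_set (nodes (restr n z)).
  apply: (@sub_finite_set _ _ [set u | nodes z u /\ (size u < n.+1)%N]) => //.
  exact: finite_below.
have fm (z : mtree) : finite_set [set u | mark (restr n z) u].
  by apply: (sub_finite_set _ (fN z)) => u; exact: mark_node.
apply: mtree_eq; first exact: (fset_set_inj (fN x) (fN y)).
have /seteqP[h1 h2] := fset_set_inj (fm x) (fm y) e2.
by apply/funext => u; apply/idP/idP => [/h1|/h2].
Qed.

(** * Branching property *)

(** A set saturated for [restr n] is the preimage of its own image. All measurability below is
    reduced to this: it suffices to see which generation an expression depends on. *)
Lemma measurable_restr n (A : set mtree) :
  (forall x y, restr n x = restr n y -> A x -> A y) -> measurable (A : set mtreeF).
Proof.
move=> hA; apply: sub_sigma_algebra; exists n => //.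
exists (restr n @` A) => //; rewrite setTI; apply/seteqP; split => x /=.
  by move=> [y Ay e]; exact: hA e Ay.
by move=> Ax; exists x.
Qed.

Lemma measurable_fun_restr n d (T : measurableType d) (D : set mtreeF) (g : mtreeF -> T) :
  measurable D -> (forall x y, restr n x = restr n y -> g x = g y) ->
  measurable_fun D g.
Proof.
move=> mD hg _ B _; apply: measurableI => //.
by apply: (@measurable_restr n) => x y /hg /= ->.
Qed.

Lemma Fn_restr n D x y : Fn n D -> restr n x = restr n y -> D x -> D y.
Proof. by move=> [B _ <-] e [_ /= Bx]; split => //=; rewrite -e. Qed.

Lemma measurable_Fn n (D : set mtree) : Fn n D -> measurable (D : set mtreeF).
Proof. by move=> FD; apply: (@measurable_restr n) => x y; exact: Fn_restr. Qed.

Lemma Fn_le n k (D : set mtree) : (n <= k)%N -> Fn n D -> Fn k D.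
Proof.
move=> nk FD; exists (restr k @` D) => //; rewrite setTI; apply/seteqP.
split => x /=; last by exists x.
by move=> [y Dy /(restr_le nk) e]; exact: Fn_restr FD e Dy.
Qed.

Section partition.
Local Open Scope ereal_scope.
Context d (T : measurableType d) (R : realType) (mu : {measure set T -> \bar R}).

Lemma ge0_integral_fibers (c : T -> nat) (D : set T) (g : T -> \bar R) :
  (forall i, measurable (c @^-1` [set i])) -> measurable D ->
  measurable_fun D g -> (forall x, D x -> 0 <= g x) ->
  \int[mu]_(x in D) g x =
  \sum_(i <oo) \int[mu]_(x in D `&` c @^-1` [set i]) g x.
Proof.
move=> mc mD mg g0.
have DE : D = \bigcup_i (D `&` c @^-1` [set i]).
  by apply/seteqP; split => [x Dx|x [i _ []]//]; exists (c x).
rewrite {1}DE; apply: ge0_integral_bigcup.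
- by move=> i; exact: measurableI.
- by rewrite -DE.
- by rewrite -DE.
- by move=> i j _ _ [x [[_ /= <-] [_ /= <-]]].
Qed.

Lemma ge0_integral_bool (b : T -> bool) (D : set T) (g : T -> \bar R) :
  measurable (b @^-1` [set true]) -> measurable D ->
  measurable_fun D g -> (forall x, D x -> 0 <= g x) ->
  \int[mu]_(x in D) g x = \int[mu]_(x in D `&` b @^-1` [set true]) g x +
    \int[mu]_(x in D `&` b @^-1` [set false]) g x.
Proof.
move=> mb mD mg g0.
have mb' : measurable (b @^-1` [set false]).
  rewrite (_ : _ @^-1` _ = ~` (b @^-1` [set true])); first exact: measurableC.
  by apply/seteqP; split => x /=; case: (b x).
have DE : D = (D `&` b @^-1` [set true]) `|` (D `&` b @^-1` [set false]).
  rewrite -setIUr; apply/seteqP; split => [x Dx|x []//].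
  by split => //=; case: (b x); [left|right].
rewrite {1}DE ge0_integral_setU//; try exact: measurableI.
- by rewrite -DE.
- by rewrite -DE.
- by apply/disj_setPS => x /= [[_ ->] []].
Qed.

End partition.

Section one_step.
Local Open Scope ereal_scope.
Context {R : realType}.

(** Averages over one unexposed node, of weight [a k] = p(k) times the mean of s^mark given k
    children; [c] counts the children already found. The j-th iterate therefore averages over j
    independent nodes. Values are extended reals, so that sums can be rearranged before any
    finiteness is known. *)
Definition offspring_op (a : nat -> R) (phi : nat -> \bar R) (c : nat) : \bar R :=
  \sum_(0 <= k <oo) (a k)%:E * phi (c + k)%N.

Lemma offspring_op_ge0 a phi c : (forall k, 0 <= a k)%R -> (forall k, 0 <= phi k) ->
  0 <= offspring_op a phi c.
Proof.
move=> a0 phi0; apply: nneseries_ge0 => k _ _; apply: mule_ge0 => //.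
by rewrite lee_fin.
Qed.

Lemma iter_offspring_op_ge0 a phi j c : (forall k, 0 <= a k)%R ->
  (forall k, 0 <= phi k) -> 0 <= iter j (offspring_op a) phi c.
Proof.
by move=> a0 phi0; elim: j c => [|j IH] c //=; apply: offspring_op_ge0.
Qed.

Variables (p q : nat -> R) (P : probability mtreeF R) (s : R).
Hypotheses (hp : offspring_distribution p) (hq : mark_function q)
  (hP : marked_GW p q P) (hs : (0 < s < 1)%R).

Let a k := alpha p q k s.

Lemma p0_ge0 k b : (0 <= p0 p q k b)%R.
Proof.
have p_ge0 := hp.1 k; have /andP[q0 q1] := hq k.
by rewrite /p0; case: b; apply: mulr_ge0 => //; rewrite subr_ge0.
Qed.

Lemma alphaE k : a k = (p0 p q k true * s + p0 p q k false)%R.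
Proof. by rewrite /a /alpha /p0 -addrA mulrDr (mulrC s) mulrA. Qed.

Lemma alpha_ge0 k : (0 <= a k)%R.
Proof.
case/andP: hs => s0 _.
by rewrite alphaE addr_ge0 ?p0_ge0// mulr_ge0 ?p0_ge0// ltW.
Qed.

Section atom.
Variables (n : nat) (w : mtree) (phi : nat -> \bar R).
Hypothesis phi_ge0 : forall k, 0 <= phi k.

Let Q := (\big[*%R/1%R]_(u \in [set u | nodes w u /\ (size u < n)%N])
  p0 p q (nchildren w u) (mark w u))%R.

Let atom : set mtreeF := [set x | restr n x = restr n w].

Let cyl (vs : seq (seq nat)) K E : set mtreeF := [set x | restr n x = restr n w /\
  forall u, u \in vs -> nchildren x u = K u /\ mark x u = E u].

Let nchildren_restrS x y u : restr n.+1 x = restr n.+1 y ->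
  restr n x = restr n w -> u \in level n w -> nchildren x u = nchildren y u.
Proof.
move=> exy xw; rewrite -(restr_level xw) => /mem_level[xu un].
by apply: (restr_nchildren exy) => //; rewrite un.
Qed.

Let mark_restrS x y u : restr n.+1 x = restr n.+1 y ->
  u \in level n w -> mark x u = mark y u.
Proof. by move=> /restr_eqP[_ em] /mem_level[_ un]; apply: em; rewrite un. Qed.

Let measurable_cyl vs K E : {subset vs <= level n w} -> measurable (cyl vs K E).
Proof.
move=> vsw; apply: (@measurable_restr n.+1) => x y exy [xw h].
have yw : restr n y = restr n w by rewrite -(restr_le (leqnSn n) exy).
split => // u uvs; have uw := vsw _ uvs.
by rewrite -(nchildren_restrS exy) -?(mark_restrS exy)//; exact: h.
Qed.

Let measurable_expose us c (D : set mtreeF) : {subset us <= level n w} ->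
  measurable D -> D `<=` atom ->
  measurable_fun D (fun x => (s ^+ (\sum_(u <- us) mark x u)%N)%:E *
    phi (c + \sum_(u <- us) nchildren x u)%N).
Proof.
move=> usw mD Dw _ B mB.
suff -> : D `&` (fun x => (s ^+ (\sum_(u <- us) mark x u)%N)%:E *
    phi (c + \sum_(u <- us) nchildren x u)%N) @^-1` B =
  D `&` (atom `&` (fun x => (s ^+ (\sum_(u <- us) mark x u)%N)%:E *
    phi (c + \sum_(u <- us) nchildren x u)%N) @^-1` B).
  apply: measurableI => //; apply: (@measurable_restr n.+1) => x y exy [xw Bx].
  have yw : restr n y = restr n w by rewrite -(restr_le (leqnSn n) exy).
  split => //=; move: Bx => /=; congr (B (_%:E * _)).
    by congr (_ ^+ _)%R; apply: eq_big_seq => u /usw /(mark_restrS exy) ->.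
  by congr (phi (_ + _)%N); apply: eq_big_seq => u /usw /(nchildren_restrS exy xw).
by rewrite setIA (setIidl Dw).
Qed.

(* The nodes of level n are exposed one at a time: those in [vs] have been, those in [us]
   remain. *)
Lemma integral_expose us vs K E c : perm_eq (vs ++ us) (level n w) ->
  \int[P]_(x in cyl vs K E) ((s ^+ (\sum_(u <- us) mark x u)%N)%:E *
    phi (c + \sum_(u <- us) nchildren x u)%N) =
  (Q * \prod_(u <- vs) p0 p q (K u) (E u))%:E *
    iter (size us) (offspring_op a) phi c.
Proof.
have s0 : (0 <= s)%R by case/andP: hs => /ltW.
elim: us vs K E c => [|u us IH] vs K E c pw.
  rewrite cats0 in pw.
  transitivity (\int[P]_(x in cyl vs K E) cst (phi c) x).
    by apply: eq_integral => x _; rewrite !big_nil expr0 mul1e addn0.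
  rewrite integral_cst; last by apply: measurable_cyl => u; rewrite (perm_mem pw).
  rewrite /= muleC; congr (_ * _).
  (* Once all of level n is prescribed, the cylinder is a single atom of level n.+1, represented by
     the tree [ext_mtree], and [marked_GW] gives its probability. *)
  have -> : cyl vs K E = [set x : mtreeF | restr n.+1 x = restr n.+1 (ext_mtree w n K E)].
    apply/seteqP; split => x /=.
      move=> [xw h]; apply/restrS_ext; split => // u.
      by rewrite -(perm_mem pw); exact: h.
    by move/restrS_ext => [xw h]; split=> // u; rewrite (perm_mem pw); exact: h.
  rewrite hP// fsbig_belowS ext_level; congr (_ * _)%R%:E.
    rewrite /Q (_ : [set u | nodes w u /\ _] =
        [set u | nodes (ext_mtree w n K E) u /\ (size u < n)%N]).
      apply: eq_fsbigr => u; rewrite inE /= => -[xu un].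
      rewrite -(ext_markE w K E un).
      by rewrite (restr_nchildren (restr_ext w n K E)).
    by apply/seteqP; split => u [xu un]; split => //;
      apply/(ext_nodesE w K E (ltnW un)).
  rewrite -(perm_big _ pw); apply: eq_big_seq => u; rewrite (perm_mem pw) => uw.
  by rewrite nchildren_ext// mark_ext.
have uw : u \in level n w by rewrite -(perm_mem pw) mem_cat mem_head orbT.
have vsw : {subset vs <= level n w}.
  by move=> v vvs; rewrite -(perm_mem pw) mem_cat vvs.
have usw : {subset u :: us <= level n w}.
  by move=> v vus; rewrite -(perm_mem pw) mem_cat vus orbT.
have uvs : u \notin vs.
  have := uniq_level n w; rewrite -(perm_uniq pw) cat_uniq => /and3P[_ + _].
  by rewrite /= negb_or => /andP[].
have pw' : perm_eq ((u :: vs) ++ us) (level n w).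
  by apply: perm_trans pw; rewrite perm_sym (perm_catCA vs [:: u] us).
have mcyl := measurable_cyl K E vsw.
have matom : measurable atom by apply: (@measurable_restr n) => x y e; rewrite /atom /= e.
have cylw : cyl vs K E `<=` atom by move=> x [].
pose K' k v := if v == u then k else K v.
pose E' b v := if v == u then b else E v.
have cylE k b : cyl vs K E `&` [set x : mtreeF | nchildren x u = k] `&`
    (fun x : mtreeF => mark x u) @^-1` [set b] = cyl (u :: vs) (K' k) (E' b).
  apply/seteqP; split => x /=.
    move=> [[[xw h] xk] xb]; split=> // v; rewrite inE /K' /E'.
    by case: eqP => [->//|_ /= /h].
  move=> [xw h]; have := h u (mem_head _ _); rewrite /K' /E' eqxx => -[xk xb].
  split=> //; split=> //; split=> // v vvs.
  have := h v; rewrite inE vvs orbT /K' /E' => /(_ isT).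
  by case: eqP => [vu|//]; move: uvs; rewrite -vu vvs.
have intE k b : \int[P]_(x in cyl vs K E `&` [set x : mtreeF | nchildren x u = k] `&`
    (fun x : mtreeF => mark x u) @^-1` [set b])
    ((s ^+ (\sum_(v <- u :: us) mark x v)%N)%:E *
     phi (c + \sum_(v <- u :: us) nchildren x v)%N) =
  (s ^+ b * p0 p q k b)%:E * ((Q * \prod_(v <- vs) p0 p q (K v) (E v))%:E *
    iter (size us) (offspring_op a) phi (c + k)%N).
  transitivity (\int[P]_(x in cyl (u :: vs) (K' k) (E' b))
      ((s ^+ b)%:E * ((s ^+ (\sum_(v <- us) mark x v)%N)%:E *
     phi (c + k + \sum_(v <- us) nchildren x v)%N))).
    rewrite cylE; apply: eq_integral => x; rewrite inE => -[xw h].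
    have := h u (mem_head _ _); rewrite /K' /E' eqxx => -[xk xb].
    by rewrite !big_cons xk xb exprD EFinM muleA addnA.
  have mc' : measurable (cyl (u :: vs) (K' k) (E' b)).
    by apply: measurable_cyl => v; rewrite inE => /orP[/eqP ->//|/vsw].
  rewrite ge0_integralZl_EFin//.
  - rewrite IH// big_cons {1}/K' {1}/E' eqxx muleA -EFinM.
    rewrite (_ : (\prod_(_ <- _) _ = \prod_(v <- vs) p0 p q (K v) (E v))%R).
      rewrite [RHS]muleA -EFinM; congr (_%:E * _).
      ring.
    apply: eq_big_seq => v vvs; rewrite /K' /E'.
    by case: eqP => [vu|//]; move: uvs; rewrite -vu vvs.
  - by move=> x _; rewrite mule_ge0// lee_fin exprn_ge0.
  - apply: measurable_expose => //; last by move=> x [].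
    by move=> v vus; apply: usw; rewrite inE vus orbT.
  - exact: exprn_ge0.
have mu_k k : measurable (cyl vs K E `&` [set x : mtreeF | nchildren x u = k]).
  apply: (@measurable_restr n.+1) => x y exy [[xw h] xk].
  have yw : restr n y = restr n w by rewrite -(restr_le (leqnSn n) exy).
  split=> /=; last by rewrite -(nchildren_restrS exy).
  split=> // v vvs.
  rewrite -(nchildren_restrS exy)//; last exact: vsw.
  by rewrite -(mark_restrS exy) ?vsw//; exact: h.
(* The fibres of [nchildren ^~ u] are only known to be measurable inside the atom. *)
pose num (x : mtreeF) := if x \in atom then nchildren x u else 0%N.
rewrite (@ge0_integral_fibers _ _ _ _ num)//.
- rewrite iterS /offspring_op -nneseriesZl; last first.
    move=> k _; rewrite mule_ge0 ?lee_fin ?alpha_ge0//.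
    by apply: iter_offspring_op_ge0 => //; exact: alpha_ge0.
  apply: eq_eseriesr => k _.
  have -> : cyl vs K E `&` num @^-1` [set k] =
      cyl vs K E `&` [set x : mtreeF | nchildren x u = k].
    by apply/seteqP; split => x [cx] /=; rewrite /num (mem_set (cylw _ cx)) => h.
  rewrite (@ge0_integral_bool _ _ _ _ (fun x : mtreeF => mark x u))//.
  + have sp0 (b : bool) : (0 <= s ^+ b * p0 p q k b)%R.
      by apply: mulr_ge0; [exact: exprn_ge0|exact: p0_ge0].
    (* The two possible marks of u contribute s p0(k,1) + p0(k,0), which is [a k]. *)
    rewrite !intE -ge0_muleDl ?lee_fin//.
    rewrite muleCA; congr (_ * _); rewrite -EFinD; congr (_%:E * _).
    by rewrite -/(a k) alphaE expr0 expr1 mul1r mulrC.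
  + by apply: (@measurable_restr n.+1) => x y exy /=; rewrite (mark_restrS exy).
  + by apply: measurable_expose => //; move=> x [/cylw].
  + by move=> x _; rewrite mule_ge0// lee_fin exprn_ge0.
- move=> k; apply: (@measurable_restr n.+1) => x y exy /=; rewrite /num.
  have exy' := restr_le (leqnSn n) exy.
  have -> : (y \in atom) = (x \in atom).
    by apply/idP/idP; rewrite !inE /atom /= exy'.
  by case: ifPn => // /set_mem xw; rewrite (nchildren_restrS exy).
- exact: measurable_expose.
- by move=> x _; rewrite mule_ge0// lee_fin exprn_ge0.
Qed.

(** [marked_GW] speaks of positive heights only. At height 0 all trees have the same restriction and
    the product is empty. *)
Lemma prob_atom : P atom = Q%:E.
Proof.
have [n0|n0] := posnP n; last exact: hP.
rewrite /Q /atom n0 (_ : [set u | _ /\ _] = set0).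
  rewrite fsbig_set0 (_ : [set _ | _] = setT) ?probability_setT//.
  apply/seteqP; split => // x _; apply/restr_eqP; split => // u.
  rewrite leqn0 => /nilP ->; split => _; exact: nodes_root.
by apply/seteqP; split => u // [].
Qed.

Lemma integral_one_step_atom :
  \int[P]_(x in atom) ((s ^+ Mn n.+1 x)%:E * phi (Zn n.+1 x)) =
  \int[P]_(x in atom) ((s ^+ Mn n x)%:E * iter (Zn n x) (offspring_op a) phi 0%N).
Proof.
have s0 : (0 <= s)%R by case/andP: hs => /ltW.
have matom : measurable atom by apply: (@measurable_restr n) => x y e; rewrite /atom /= e.
have -> : \int[P]_(x in atom) ((s ^+ Mn n x)%:E * iter (Zn n x) (offspring_op a) phi 0%N) =
  \int[P]_(x in atom) cst ((s ^+ Mn n w)%:E * iter (Zn n w) (offspring_op a) phi 0%N) x.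
  apply: eq_integral => x; rewrite inE /atom /= => xw.
  by rewrite (restr_Mn xw) (restr_Zn xw).
rewrite integral_cst//.
rewrite [X in _ = _ * X](_ : _ = Q%:E); last exact: prob_atom.
have -> : \int[P]_(x in atom) ((s ^+ Mn n.+1 x)%:E * phi (Zn n.+1 x)) =
  \int[P]_(x in cyl [::] (fun=> 0%N) (fun=> false)) ((s ^+ Mn n w)%:E *
   ((s ^+ (\sum_(u <- level n w) mark x u)%N)%:E *
    phi (0 + \sum_(u <- level n w) nchildren x u)%N)).
  rewrite (_ : cyl _ _ _ = atom); last by apply/seteqP; split => x => [[]//|xw]; split.
  apply: eq_integral => x; rewrite inE /atom /= => xw.
  by rewrite MnS ZnS (restr_Mn xw) (restr_level xw) exprD EFinM muleA add0n.
rewrite ge0_integralZl_EFin//.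
- by rewrite integral_expose// big_nil mulr1 -muleA [Q%:E * _]muleC.
- exact: measurable_cyl.
- by move=> x _; rewrite mule_ge0// lee_fin exprn_ge0.
- by apply: measurable_expose => //; [exact: measurable_cyl|move=> x []].
- exact: exprn_ge0.
Qed.

End atom.

(* The branching property: given F_n, the nodes of level n reproduce independently. *)
Lemma integral_one_step n (D : set mtreeF) (phi : nat -> \bar R) : Fn n D ->
  (forall k, 0 <= phi k) ->
  \int[P]_(x in D) ((s ^+ Mn n.+1 x)%:E * phi (Zn n.+1 x)) =
  \int[P]_(x in D) ((s ^+ Mn n x)%:E * iter (Zn n x) (offspring_op a) phi 0%N).
Proof.
move=> FD phi0; have mD := measurable_Fn FD.
have s0 : (0 <= s)%R by case/andP: hs => /ltW.
have mcode i : measurable (code n @^-1` [set i] : set mtreeF).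
  by apply: (@measurable_restr n) => x y /code_eq /= ->.
rewrite (@ge0_integral_fibers _ mtreeF _ P (code n))//; last 2 first.
- apply: (@measurable_fun_restr n.+1) => // x y e.
  by rewrite (restr_Mn e) (restr_Zn e).
- by move=> x _; rewrite mule_ge0// lee_fin exprn_ge0.
rewrite [RHS](@ge0_integral_fibers _ mtreeF _ P (code n))//; last 2 first.
- apply: (@measurable_fun_restr n) => // x y e.
  by rewrite (restr_Mn e) (restr_Zn e).
- move=> x _; rewrite mule_ge0// ?lee_fin ?exprn_ge0//.
  by apply: iter_offspring_op_ge0 => //; exact: alpha_ge0.
apply: eq_eseriesr => i _.
have [[w [Dw <-]]|nw] := pselect (exists w, D w /\ code n w = i); last first.
  rewrite (_ : D `&` _ = set0) ?integral_set0//.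
  by apply/seteqP; split => // x [Dx xi]; apply: nw; exists x.
rewrite (_ : D `&` _ = [set x | restr n x = restr n w]).
  exact: integral_one_step_atom.
apply/seteqP; split => x /=; first by move=> [_ /code_eq].
by move=> e; split; [exact: Fn_restr FD (esym e) Dw|exact/code_eq].
Qed.

End one_step.

(** * Sequences, powers and coefficients of powers of polynomials *)

Section real_lemmas.
Context {R : realType}.
Implicit Types (x y : R) (u : nat -> R).

(** k x^k is at most the sum of the k larger powers x^0, ..., x^(k-1), a partial geometric
    series. *)
Lemma nat_expr_le x k : 0 <= x < 1 -> k%:R * x ^+ k <= (1 - x)^-1.
Proof.
move=> /andP[x0 x1]; have x1' : 0 < 1 - x by rewrite subr_gt0.
rewrite -[leRHS]mul1r ler_pdivlMr//.
apply: (@le_trans _ _ ((1 - x) * \sum_(i < k) x ^+ i)); last first.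
  by rewrite -opprB mulNr -subrX1 opprB gerBl exprn_ge0.
rewrite [leLHS]mulrC ler_wpM2l ?(ltW x1')//.
have -> : k%:R * x ^+ k = \sum_(i < k) x ^+ k by rewrite sumr_const card_ord mulr_natl.
by apply: ler_sum => i _; apply: ler_wiXn2l; rewrite ?(ltW x1)// ltnW.
Qed.

(** With x^k = sqrt(x)^k sqrt(x)^k, one half absorbs a single factor k and the other, by induction,
    the remaining l - 1. *)
Lemma natX_expr_bounded l x : 0 <= x < 1 ->
  exists2 C, 0 <= C & forall k, k%:R ^+ l * x ^+ k <= C.
Proof.
elim: l x => [|l IH] x /andP[x0 x1].
  by exists 1 => // k; rewrite expr0 mul1r exprn_ile1// ltW.
have s01 : 0 <= Num.sqrt x < 1 by rewrite sqrtr_ge0/= -sqrtr1 ltr_sqrt.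
have [C C0 hC] := IH _ s01.
have s1 : 0 <= (1 - Num.sqrt x)^-1 by rewrite invr_ge0 subr_ge0 ltW//; case/andP: s01.
exists ((1 - Num.sqrt x)^-1 * C) => [|k]; first exact: mulr_ge0.
rewrite -{1}(sqr_sqrtr x0) -exprM mulnC mulnC mul2n -addnn exprD exprS mulrACA.
have sk : 0 <= Num.sqrt x ^+ k by rewrite exprn_ge0// sqrtr_ge0.
by apply: ler_pM; rewrite ?mulr_ge0 ?exprn_ge0 ?hC ?nat_expr_le.
Qed.

Lemma geometric_decay u theta m0 : (forall m, 0 <= u m) -> 0 < theta ->
  (forall m, (m0 <= m)%N -> u m.+1 <= theta * u m) ->
  exists2 C, 0 <= C & forall m, u m <= C * theta ^+ m.
Proof.
(* Summing u_i / theta^i over all i <= m0 covers the finitely many indices at which the recursion is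
   not assumed. *)
move=> u0 th0 hu; pose C := \sum_(i < m0.+1) u i / theta ^+ i.
have C0 : 0 <= C by apply: sumr_ge0 => i _; rewrite divr_ge0// exprn_ge0// ltW.
exists C => // m; have [|] := leqP m m0.
  rewrite -ltnS => mm0; rewrite -ler_pdivrMr ?exprn_gt0// /C (bigD1 (Ordinal mm0))//=.
  by rewrite lerDl sumr_ge0// => i _; rewrite divr_ge0// exprn_ge0// ltW.
elim: m => // m IH; rewrite ltnS leq_eqVlt => /orP[/eqP <-|m0m].
  apply: (le_trans (hu _ (leqnn _))); rewrite exprS mulrCA ler_wpM2l ?(ltW th0)//.
  rewrite -ler_pdivrMr ?exprn_gt0// /C big_ord_recr/= lerDr.
  by apply: sumr_ge0 => i _; rewrite divr_ge0// exprn_ge0// ltW.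
apply: (le_trans (hu _ (ltnW m0m))).
by rewrite exprS mulrCA ler_wpM2l ?(ltW th0)// IH.
Qed.

Lemma geometric_cvg0 u theta C : (forall m, 0 <= u m) -> 0 <= theta < 1 ->
  (forall m, u m <= C * theta ^+ m) -> u m @[m --> \oo] --> 0.
Proof.
move=> u0 /andP[th0 th1] hu; apply: (@squeeze_cvgr _ _ _ _ (fun=> 0) (geometric C theta)).
- by apply: nearW => m; rewrite u0/= hu.
- exact: cvg_cst.
- by apply: cvg_geometric; rewrite ger0_norm.
Qed.

Lemma ratio_geometric u (c : nat -> R) lim : (forall m, 0 <= u m) ->
  (\forall m \near \oo, u m.+1 <= c m * u m) -> c m @[m --> \oo] --> lim ->
  lim < 1 -> exists theta C, [/\ 0 < theta < 1, 0 <= C &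
    forall m, u m <= C * theta ^+ m].
Proof.
(* The midpoint of [lim] and 1 lies strictly between them; the maximum with 1/2 keeps theta positive
   whatever the sign of [lim]. *)
move=> u0 hu hc lim1; pose theta := Num.max ((1 + lim) / 2) (1 / 2).
have th0 : 0 < theta by rewrite lt_max; apply/orP; right; lra.
have th1 : theta < 1 by rewrite gt_max; apply/andP; split; lra.
have limth : lim < theta by rewrite lt_max; apply/orP; left; lra.
have hc' := cvgr_lt _ hc _ limth.
have [m0 _ hm0] : \forall m \near \oo, u m.+1 <= theta * u m.
  near=> m; apply: (@le_trans _ _ (c m * u m)); first by near: m.
  by rewrite ler_wpM2r// ltW//; near: m; exact: hc'.
have [C C0 hC] := geometric_decay u0 th0 (fun m => hm0 m).
by exists theta, C; rewrite th0.
Unshelve. all: by end_near. Qed.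

Lemma ratio_cvg0 u (c : nat -> R) lim : (forall m, 0 <= u m) ->
  (\forall m \near \oo, u m.+1 <= c m * u m) -> c m @[m --> \oo] --> lim ->
  lim < 1 -> u m @[m --> \oo] --> 0.
Proof.
move=> u0 hu hc lim1.
have [theta [C [/andP[th0 th1] C0 hC]]] := ratio_geometric u0 hu hc lim1.
by apply: (geometric_cvg0 u0 _ hC); rewrite th1 ltW.
Qed.

(** Adding to u m the tail c theta^m / (1 - theta) of increments still to come gives a nonincreasing
    sequence. *)
Lemma geometric_increments_bounded u theta c m0 : 0 < theta < 1 ->
  (forall m, (m0 <= m)%N -> u m.+1 <= u m + c * theta ^+ m) ->
  forall m, (m0 <= m)%N -> 0 <= c -> u m <= u m0 + c * theta ^+ m0 / (1 - theta).
Proof.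
move=> /andP[th0 th1] hu m m0m c0; have th1' : 0 < 1 - theta by rewrite subr_gt0.
apply: (@le_trans _ _ (u m + c * theta ^+ m / (1 - theta))).
  by rewrite lerDl divr_ge0 ?(ltW th1')// mulr_ge0// exprn_ge0// ltW.
elim: m m0m => [|m IH]; first by rewrite leqn0 => /eqP ->.
rewrite leq_eqVlt => /orP[/eqP <-//|]; rewrite ltnS => m0m.
apply: le_trans (IH m0m); have := hu _ m0m.
have -> : c * theta ^+ m.+1 / (1 - theta) =
    c * theta ^+ m / (1 - theta) - c * theta ^+ m.
  by rewrite exprS; field; rewrite gt_eqF.
by move=> h; lra.
Qed.

Lemma cvgn_expr u (lim : R) n : u m @[m --> \oo] --> lim ->
  u m ^+ n @[m --> \oo] --> lim ^+ n.
Proof.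
move=> hu; elim: n => [|n IH].
  by rewrite expr0; under eq_fun do rewrite expr0; exact: cvg_cst.
by rewrite exprS; under eq_fun do rewrite exprS; exact: cvgM.
Qed.

Lemma expr_tangent x y k : 0 <= x -> 0 <= y ->
  x ^+ k + k%:R * x ^+ k.-1 * (y - x) <= y ^+ k.
Proof.
move=> x0 y0; elim: k => [|k IH]; first by rewrite !expr0 !mul0r addr0.
rewrite [leRHS]exprS; apply: le_trans (ler_wpM2l y0 IH).
rewrite -subr_ge0 -natr1 /=; case: k {IH} => [|k] /=.
  by rewrite !expr0 expr1; lra.
rewrite [x ^+ k.+2]exprS [x ^+ k.+1]exprS.
have -> : y * (x * x ^+ k + k.+1%:R * x ^+ k * (y - x)) -
   (x * (x * x ^+ k) + (k.+1%:R + 1) * (x * x ^+ k) * (y - x)) =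
   k.+1%:R * x ^+ k * (y - x) ^+ 2 by ring.
by rewrite mulr_ge0 ?sqr_ge0// mulr_ge0// exprn_ge0.
Qed.

Lemma expr_convex x w k : 0 <= x <= 1 -> 0 <= w <= 1 ->
  ((1 - w) * x + w) ^+ k <= (1 - w) * x ^+ k + w.
Proof.
move=> /andP[x0 x1] /andP[w0 w1]; elim: k => [|k IH]; first by rewrite !expr0; lra.
have z0 : 0 <= (1 - w) * x + w by rewrite addr_ge0// mulr_ge0// subr_ge0.
rewrite [leLHS]exprS; apply: (le_trans (ler_wpM2l z0 IH)).
rewrite -subr_ge0 exprS.
have -> : (1 - w) * (x * x ^+ k) + w - ((1 - w) * x + w) * ((1 - w) * x ^+ k + w) =
  w * (1 - w) * ((1 - x) * (1 - x ^+ k)) by ring.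
by rewrite !mulr_ge0// subr_ge0// exprn_ile1.
Qed.

End real_lemmas.

Section poly_lemmas.
Context {R : realType}.
Implicit Type X : {poly R}.

Lemma sum_expr_le (x : R) j : 0 <= x -> \sum_(i < j.+1) x ^+ (j - i) <= (x + 1) ^+ j.
Proof.
move=> x0; rewrite exprDn; apply: ler_sum => i _; rewrite expr1n mulr1.
by rewrite -{1}[_ ^+ _]mulr1n ler_wpMn2l ?exprn_ge0// bin_gt0 -ltnS.
Qed.

Lemma coef_exp_ge0 (X : {poly R}) k j : (forall i, 0 <= X`_i) -> 0 <= (X ^+ k)`_j.
Proof.
move=> X0; elim: k j => [|k IH] j; first by rewrite expr0 coef1 ler0n.
by rewrite exprS coefM sumr_ge0// => i _; rewrite mulr_ge0.
Qed.

Lemma coef0_exp (X : {poly R}) k : (X ^+ k)`_0 = X`_0 ^+ k.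
Proof.
elim: k => [|k IH]; first by rewrite !expr0 coef1.
by rewrite !exprS coefM big_ord_recl big_ord0 addr0 subnn IH.
Qed.

Lemma coef1_exp (X : {poly R}) k : (X ^+ k)`_1 = k%:R * X`_0 ^+ k.-1 * X`_1.
Proof.
elim: k => [|k IH]; first by rewrite expr0 coef1 !mul0r.
rewrite exprS coefM 2!big_ord_recl big_ord0 addr0 /= subn0 subnn coef0_exp IH.
case: k {IH} => [|k] /=; first by rewrite !expr0; ring.
by rewrite exprS -[in RHS]natr1; ring.
Qed.

(** X is dominated by c times the geometric series in K eps, and degree j can be distributed over k
    factors in at most k^j ways. *)
Lemma coef_exp_le (X : {poly R}) c K j k : 0 <= c -> 0 <= K ->
  (forall i, 0 <= X`_i) -> (forall i, (i <= j)%N -> X`_i <= c * K ^+ i) ->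
  (X ^+ k)`_j <= c ^+ k * (K * k%:R) ^+ j.
Proof.
move=> c0 K0 X0; elim: k j => [|k IH] j Xj.
  by rewrite !expr0 coef1 mul1r mulr0 expr0n.
rewrite exprS coefM (@le_trans _ _ (\sum_(i < j.+1) c ^+ k.+1 * K ^+ j * k%:R ^+ (j - i)))//.
  apply: ler_sum => i _; have ij : (i <= j)%N by rewrite -ltnS.
  apply: (@le_trans _ _ ((c * K ^+ i) * (c ^+ k * (K * k%:R) ^+ (j - i)))).
    apply: ler_pM => //; first exact: coef_exp_ge0.
      exact: Xj.
    apply: IH => h hj; apply: Xj; exact: leq_trans hj (leq_subr _ _).
  have -> : K ^+ j = K ^+ i * K ^+ (j - i) by rewrite -exprD subnKC.
  rewrite exprMn exprS.
  by rewrite le_eqVlt; apply/orP; left; apply/eqP; ring.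
rewrite -mulr_sumr exprMn mulrA ler_wpM2l ?mulr_ge0 ?exprn_ge0//.
by rewrite -natr1; exact: sum_expr_le.
Qed.

Let sum_ends (F : nat -> R) j : \sum_(i < j.+2) F i =
  F 0%N + \sum_(i < j) F i.+1 + F j.+1.
Proof. by rewrite big_ord_recr big_ord_recl. Qed.

Let sum_expr_ends (x : R) j : 0 <= x ->
  x ^+ j.+1 + \sum_(i < j) x ^+ (j - i) + 1 <= (x + 1) ^+ j.+1.
Proof.
move=> x0; have := sum_expr_le j.+1 x0.
by rewrite (sum_ends (fun i => x ^+ (j.+1 - i))) subn0 subnn expr0.
Qed.

(** A positive degree j needs at least one factor of positive index. That factor supplies y; any
    further ones are bounded using y <= 1. *)
Lemma coef_exp_le_small X y K j k : 0 <= y <= 1 -> 0 <= K -> (0 < j)%N ->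
  (forall i, 0 <= X`_i) ->
  (forall i, (0 < i <= j)%N -> X`_i <= X`_0 * y * K ^+ i) ->
  (X ^+ k)`_j <= X`_0 ^+ k * y * (K * k%:R) ^+ j.
Proof.
move=> /andP[y0 y1] K0 j0 X0; elim: k j j0 => [|k IH] [//|j] _ Xj.
  by rewrite expr0 coef1 mulr0 expr0n mulr0.
have x0 := X0 0%N; set x := X`_0 in x0 Xj IH *.
rewrite exprS coefM (sum_ends (fun i => X`_i * (X ^+ k)`_(j.+1 - i))) subn0 subnn coef0_exp.
apply: (@le_trans _ _ (x ^+ k.+1 * y * K ^+ j.+1 *
    (k%:R ^+ j.+1 + \sum_(i < j) k%:R ^+ (j - i) + 1))); last first.
  rewrite exprMn mulrA -natr1 ler_wpM2l ?sum_expr_ends//.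
  by rewrite !mulr_ge0 ?exprn_ge0.
rewrite !mulrDr mulr1; apply: lerD; first apply: lerD.
- apply: (le_trans (ler_wpM2l x0 (IH j.+1 isT Xj))).
  by rewrite exprMn [x ^+ k.+1]exprS le_eqVlt; apply/orP; left; apply/eqP; ring.
- rewrite mulr_sumr; apply: ler_sum => i _; rewrite subSS.
  have ij : (i < j)%N by [].
  apply: (@le_trans _ _ ((x * y * K ^+ i.+1) * (x ^+ k * 1 * (K * k%:R) ^+ (j - i)))).
    apply: ler_pM => //; first exact: coef_exp_ge0.
      by apply: Xj; rewrite /= ltnS ltnW.
    apply: (le_trans (IH _ _ _)); first by rewrite subn_gt0.
      move=> h /andP[h0 hj]; apply: Xj; rewrite h0 (leq_trans hj)//.
      by rewrite (leq_trans (leq_subr _ _)).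
    by rewrite ler_wpM2r ?exprn_ge0 ?mulr_ge0// ler_wpM2l// exprn_ge0.
  have -> : K ^+ j.+1 = K ^+ i.+1 * K ^+ (j - i) by rewrite -exprD addSn subnKC// ltnW.
  rewrite exprMn [x ^+ k.+1]exprS.
  by rewrite le_eqVlt; apply/orP; left; apply/eqP; ring.
- apply: (le_trans (ler_wpM2r (exprn_ge0 _ x0) (Xj j.+1 _))); first by rewrite leqnn.
  by rewrite [x ^+ k.+1]exprS le_eqVlt; apply/orP; left; apply/eqP; ring.
Qed.

(* The linear term in [X`_j] is singled out: the other ways of producing degree j use at
   least two coefficients of positive index, hence the factor [y ^+ 2]. *)
Lemma coef_exp_linear X y K j k : 0 <= y <= 1 -> 0 <= K -> (0 < j)%N ->
  (forall i, 0 <= X`_i) ->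
  (forall i, (0 < i < j)%N -> X`_i <= X`_0 * y * K ^+ i) ->
  k%:R * X`_0 ^+ k.-1 * X`_j <= (X ^+ k)`_j <=
  k%:R * X`_0 ^+ k.-1 * X`_j + X`_0 ^+ k * y ^+ 2 * (K * k%:R) ^+ j.
Proof.
move=> y01 K0 j0 X0; have /andP[y0 y1] := y01; case: j j0 => // j _ Xj.
have x0 := X0 0%N; set x := X`_0 in x0 Xj *.
elim: k => [|k /andP[IH1 IH2]].
  by rewrite expr0 coef1 !mul0r mulr0 expr0n mulr0 addr0 lexx.
rewrite exprS coefM (sum_ends (fun i => X`_i * (X ^+ k)`_(j.+1 - i))) subn0 subnn coef0_exp -/x.
(* Product rule for the linear term. The case k = 0 is separate because [k.-1] stops at 0. *)
have kE : k.+1%:R * x ^+ k.+1.-1 * X`_j.+1 =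
    x * (k%:R * x ^+ k.-1 * X`_j.+1) + X`_j.+1 * x ^+ k.
  rewrite -natr1 /=; case: k {IH1 IH2} => [|k] /=; first by rewrite expr0; ring.
  by rewrite exprS; ring.
apply/andP; split.
  rewrite kE lerD2r; apply: (le_trans (ler_wpM2l x0 IH1)); rewrite lerDl sumr_ge0// => i _.
  by rewrite mulr_ge0// coef_exp_ge0.
set S := \sum_(i < j) k%:R ^+ (j - i) : R.
(* Mixed terms: the first factor and X^k both have positive degree, so each supplies one y. *)
have hS : \sum_(i < j) X`_i.+1 * (X ^+ k)`_(j.+1 - i.+1) <=
    x ^+ k.+1 * y ^+ 2 * K ^+ j.+1 * S.
  rewrite mulr_sumr; apply: ler_sum => i _; rewrite subSS.
  have ij : (i < j)%N by [].
  apply: (@le_trans _ _ ((x * y * K ^+ i.+1) * (x ^+ k * y * (K * k%:R) ^+ (j - i)))).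
    apply: ler_pM => //; first exact: coef_exp_ge0.
      by apply: Xj; rewrite /= ltnS.
    apply: coef_exp_le_small => //; first by rewrite subn_gt0.
    move=> h /andP[h0 hj]; apply: Xj; rewrite h0 ltnS (leq_trans hj)//.
    exact: leq_subr.
  have -> : K ^+ j.+1 = K ^+ i.+1 * K ^+ (j - i) by rewrite -exprD addSn subnKC// ltnW.
  rewrite exprMn [x ^+ k.+1]exprS.
  by rewrite le_eqVlt; apply/orP; left; apply/eqP; ring.
have h0 : 0 <= x ^+ k.+1 * y ^+ 2 * K ^+ j.+1 by rewrite !mulr_ge0 ?exprn_ge0.
have hE : x ^+ k.+1 * y ^+ 2 * K ^+ j.+1 * (k%:R ^+ j.+1 + S) <=
    x ^+ k.+1 * y ^+ 2 * (K * k.+1%:R) ^+ j.+1.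
  rewrite [X in _ <= _ * X]exprMn [leRHS]mulrA ler_wpM2l// -natr1.
  by apply: le_trans (sum_expr_ends j (ler0n R k)); rewrite lerDl.
have h1 := ler_wpM2l x0 IH2.
have hk : x * (x ^+ k * y ^+ 2 * (K * k%:R) ^+ j.+1) =
    x ^+ k.+1 * y ^+ 2 * K ^+ j.+1 * k%:R ^+ j.+1.
  by rewrite exprMn [x ^+ k.+1]exprS; ring.
rewrite mulrDr hk in h1; rewrite mulrDr in hE.
rewrite kE; lra.
Qed.

End poly_lemmas.

(** * Generating functions acting on truncated power series *)

Section weighted_sums.
Context {R : realType}.
Variables (a : nat -> R) (L : nat).
Hypothesis a_ge0 : forall k, 0 <= a k.
Hypothesis a_moment : (\sum_(0 <= k <oo) (a k * k.+1%:R ^+ L)%:E < +oo)%E.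

Implicit Types g h : nat -> R.

Definition wsum g : R := fine (\sum_(0 <= k <oo) (a k * g k)%:E)%E.

(** Under [a_moment] this makes the series behind [wsum] finite, so that [fine] loses nothing. The
    power of k + 1, rather than of k, lets constants be tame. *)
Definition tame g := exists C, forall k, 0 <= g k <= C * k.+1%:R ^+ L.

Lemma tame_ge0 g k : tame g -> 0 <= g k.
Proof. by case=> C /(_ k) /andP[]. Qed.

Lemma wsumE g : tame g -> (\sum_(0 <= k <oo) (a k * g k)%:E = (wsum g)%:E)%E.
Proof.
move=> [C hC]; have C0 : 0 <= C.
  by have /andP[g0] := hC 0%N; rewrite expr1n mulr1; exact: le_trans.
rewrite fineK// ge0_fin_numE; last first.
  by apply: nneseries_ge0 => k _ _; rewrite lee_fin mulr_ge0//; have /andP[] := hC k.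
apply: (@le_lt_trans _ _ (C%:E * \sum_(0 <= k <oo) (a k * k.+1%:R ^+ L)%:E)%E).
  rewrite -nneseriesZl; last by move=> k _; rewrite lee_fin mulr_ge0// exprn_ge0.
  apply: lee_nneseries => [k _ _|k _]; have /andP[g0 gC] := hC k.
    by rewrite lee_fin mulr_ge0.
  by rewrite -EFinM lee_fin mulrCA ler_wpM2l.
by apply: lte_mul_pinfty.
Qed.

Lemma eq_wsum g h : g =1 h -> wsum g = wsum h.
Proof. by move=> e; rewrite (funext e). Qed.

Lemma tame_le g h : (forall k, 0 <= g k <= h k) -> tame h -> tame g.
Proof.
move=> gh [C hC]; exists C => k; have /andP[-> /=] := gh k.
by move/le_trans; apply; have /andP[] := hC k.
Qed.

Lemma tameD g h : tame g -> tame h -> tame (fun k => g k + h k).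
Proof.
move=> [C hC] [D hD]; exists (C + D) => k.
have /andP[g0 gC] := hC k; have /andP[h0 hD'] := hD k.
by rewrite addr_ge0// mulrDl lerD.
Qed.

Lemma tameZ c g : 0 <= c -> tame g -> tame (fun k => c * g k).
Proof.
move=> c0 [C hC]; exists (c * C) => k; have /andP[g0 gC] := hC k.
by rewrite mulr_ge0// -mulrA ler_wpM2l.
Qed.

Lemma tame_cst c : 0 <= c -> tame (fun=> c).
Proof.
move=> c0; exists c => k; rewrite c0 ler_peMr// exprn_ege1//.
by rewrite ler1n.
Qed.

Lemma tame_sum (n : nat) (F : nat -> nat -> R) : (forall i, tame (F i)) ->
  tame (fun k => \sum_(i < n) F i k).
Proof.
move=> tF; elim: n => [|n IH].
  by under eq_fun do rewrite big_ord0; exact: tame_cst.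
by under eq_fun do rewrite big_ord_recr /=; exact: tameD.
Qed.

Lemma tame_natX j : (j <= L)%N -> tame (fun k => k%:R ^+ j).
Proof.
move=> jL; exists 1 => k; rewrite exprn_ge0// mul1r /=.
apply: (@le_trans _ _ (k.+1%:R ^+ j)); first by rewrite lerXn2r ?nnegrE// ler_nat.
by apply: ler_weXn2l => //; rewrite ler1n.
Qed.

Lemma tameX x : 0 <= x <= 1 -> tame (fun k => x ^+ k).
Proof.
move=> /andP[x0 x1]; apply: (@tame_le _ (fun=> 1)); last exact: tame_cst.
by move=> k; rewrite exprn_ge0//= exprn_ile1.
Qed.

Lemma tame_XnatX x j : (j <= L)%N -> 0 <= x <= 1 ->
  tame (fun k => x ^+ k * k%:R ^+ j).
Proof.
move=> jL /andP[x0 x1]; apply: (@tame_le _ (fun k => k%:R ^+ j)); last exact: tame_natX.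
by move=> k; rewrite mulr_ge0 ?exprn_ge0//= ler_piMl ?exprn_ge0// exprn_ile1.
Qed.

Lemma wsum_ge0 g : tame g -> 0 <= wsum g.
Proof.
move=> tg; apply: fine_ge0; apply: nneseries_ge0 => k _ _.
by rewrite lee_fin mulr_ge0//; exact: tame_ge0.
Qed.

Lemma le_wsum g h : tame g -> tame h -> (forall k, a k != 0 -> g k <= h k) ->
  wsum g <= wsum h.
Proof.
move=> tg th gh; rewrite -lee_fin -!wsumE//; apply: lee_nneseries => [k _ _|k _].
  by rewrite lee_fin mulr_ge0//; exact: tame_ge0.
rewrite lee_fin; have [->|ak] := eqVneq (a k) 0; first by rewrite !mul0r.
by apply: ler_wpM2l => //; exact: gh.
Qed.

Lemma wsumD g h : tame g -> tame h -> wsum (fun k => g k + h k) = wsum g + wsum h.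
Proof.
move=> tg th; apply: EFin_inj; rewrite EFinD -!wsumE//; last exact: tameD.
rewrite -nneseriesD.
- by apply: eq_eseriesr => k _; rewrite mulrDr EFinD.
- by move=> k _ _; rewrite lee_fin mulr_ge0//; exact: tame_ge0.
- by move=> k _ _; rewrite lee_fin mulr_ge0//; exact: tame_ge0.
Qed.

Lemma wsumZ c g : 0 <= c -> tame g -> wsum (fun k => c * g k) = c * wsum g.
Proof.
move=> c0 tg; apply: EFin_inj; rewrite EFinM -!wsumE//; last exact: tameZ.
rewrite -nneseriesZl; last by move=> k _; rewrite lee_fin mulr_ge0//; exact: tame_ge0.
by apply: eq_eseriesr => k _; rewrite -EFinM mulrCA.
Qed.

Lemma wsum_sum (n : nat) (F : nat -> nat -> R) : (forall i, tame (F i)) ->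
  wsum (fun k => \sum_(i < n) F i k) = \sum_(i < n) wsum (F i).
Proof.
move=> tF; elim: n => [|n IH].
  rewrite big_ord0; apply: EFin_inj; rewrite -wsumE.
    by apply: eseries0 => k _ _; rewrite big_ord0 mulr0.
  by under eq_fun do rewrite big_ord0; exact: tame_cst.
rewrite big_ord_recr /= -IH -wsumD//; last exact: tame_sum.
by apply: eq_wsum => k; rewrite big_ord_recr.
Qed.

Lemma tame_single g j : tame g -> tame (fun k => if k == j then g j else 0).
Proof.
move=> tg; apply: (@tame_le _ g) => // k.
by case: eqP => [->|_]; rewrite ?lexx ?tame_ge0.
Qed.

Lemma wsum_single g j : tame g -> wsum (fun k => if k == j then g j else 0) = a j * g j.
Proof.
move=> tg; apply: EFin_inj; rewrite -wsumE; last exact: tame_single.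
rewrite (nneseriesD1 (n := j))//.
- rewrite eqxx eseries0 ?adde0// => k _ /andP[_ /negbTE ->].
  by rewrite mulr0.
- by move=> k _; rewrite lee_fin mulr_ge0//; exact: (tame_ge0 _ (tame_single j tg)).
Qed.

Lemma wsum_term g j : tame g -> a j * g j <= wsum g.
Proof.
move=> tg; rewrite -wsum_single//; apply: le_wsum => //; first exact: tame_single.
by move=> k _; case: eqP => [->//|_]; exact: tame_ge0.
Qed.

(* Polynomials stand for power series modulo degree [L.+1]: [fpol X] is f(X) for the generating
   function f of [a]. *)
Definition jet (X : {poly R}) := (forall i, 0 <= X`_i) /\ X`_0 <= 1.

(** As the constant coefficient is at most 1, the coefficient of index j in X^k grows only like k^j.
    This is where the moment of order L pays for j <= L. *)
Lemma tame_coef_exp X j : (j <= L)%N -> jet X -> tame (fun k => (X ^+ k)`_j).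
Proof.
move=> jL [X0 X1]; pose K := 1 + \sum_(i < j.+1) X`_i.
have K1 : 1 <= K by rewrite lerDl sumr_ge0.
have K0 : 0 <= K by exact: le_trans K1.
have XK i : (i <= j)%N -> X`_i <= 1 * K ^+ i.
  rewrite mul1r; case: i => [_|i ij]; first by rewrite expr0.
  apply: (@le_trans _ _ K); last by rewrite exprS ler_peMr// exprn_ege1.
  rewrite /K (bigD1 (Ordinal (_ : (i.+1 < j.+1)%N)))//= addrCA lerDl.
  by rewrite addr_ge0// sumr_ge0.
apply: (@tame_le _ (fun k => K ^+ j * k%:R ^+ j)).
  move=> k; rewrite coef_exp_ge0//= (le_trans (coef_exp_le k ler01 K0 X0 XK))//.
  by rewrite expr1n mul1r exprMn.
by apply: tameZ; [exact: exprn_ge0|exact: tame_natX].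
Qed.

Definition fpol (X : {poly R}) : {poly R} :=
  \poly_(j < L.+1) wsum (fun k => (X ^+ k)`_j).

Lemma coef_fpol X j : (j <= L)%N -> (fpol X)`_j = wsum (fun k => (X ^+ k)`_j).
Proof. by move=> jL; rewrite coef_poly ltnS jL. Qed.

Lemma coef_fpol_ge0 X j : jet X -> 0 <= (fpol X)`_j.
Proof.
move=> jX; rewrite coef_poly ltnS; case: ifP => // jL.
by apply: wsum_ge0; exact: tame_coef_exp.
Qed.

Definition gf x := wsum (fun k => x ^+ k).
Definition dgf x := wsum (fun k => k%:R * x ^+ k.-1).

Lemma coef0_fpol X : (fpol X)`_0 = gf X`_0.
Proof. by rewrite coef_fpol//; apply: eq_wsum => k; rewrite coef0_exp. Qed.

Hypothesis L_gt0 : (0 < L)%N.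

Lemma tame_deriv x : 0 <= x <= 1 -> tame (fun k => k%:R * x ^+ k.-1).
Proof.
move=> /andP[x0 x1]; apply: (@tame_le _ (fun k => k%:R ^+ 1)).
  by move=> k; rewrite mulr_ge0 ?exprn_ge0//= expr1 ler_piMr// exprn_ile1.
exact: tame_natX.
Qed.

Lemma coef1_fpol X : jet X -> (fpol X)`_1 = dgf X`_0 * X`_1.
Proof.
move=> [X0 X1]; rewrite coef_fpol// mulrC /dgf -wsumZ//.
  by apply: eq_wsum => k; rewrite coef1_exp mulrC.
by apply: tame_deriv; rewrite X0.
Qed.

Hypothesis gf1_lt1 : gf 1 < 1.

Lemma gf_ge0 x : 0 <= x <= 1 -> 0 <= gf x.
Proof. by move=> x01; apply: wsum_ge0; exact: tameX. Qed.

Lemma gf_le x y : 0 <= x -> x <= y -> y <= 1 -> gf x <= gf y.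
Proof.
move=> x0 xy y1; apply: le_wsum; first by apply: tameX; rewrite x0 (le_trans xy).
  by apply: tameX; rewrite y1 (le_trans x0).
by move=> k _; rewrite lerXn2r ?nnegrE// (le_trans x0).
Qed.

Lemma jet_fpol X : jet X -> jet (fpol X).
Proof.
move=> jX; split; first by move=> i; exact: coef_fpol_ge0.
rewrite coef0_fpol; apply: le_trans (ltW gf1_lt1).
by apply: gf_le => //; [exact: jX.1|exact: jX.2].
Qed.

Lemma jet_iter_fpol X m : jet X -> jet (iter m fpol X).
Proof. by move=> jX; elim: m => [|m IH] //=; exact: jet_fpol. Qed.

(** Averaging over one node replaces its factor X^k by f(X). The spectator Y holds the factors of
    nodes already averaged, which makes the statement iterable. *)
Lemma offspring_op_coef (X Y : {poly R}) j c : (j <= L)%N -> jet X -> (forall i, 0 <= Y`_i) ->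
  offspring_op a (fun k => ((X ^+ k * Y)`_j)%:E) c = ((X ^+ c * (fpol X * Y))`_j)%:E.
Proof.
move=> jL jX Y0; rewrite mulrCA.
pose Z := X ^+ c * Y; have Z0 i : 0 <= Z`_i.
  by rewrite coefM sumr_ge0// => h _; rewrite mulr_ge0// coef_exp_ge0//; exact: jX.1.
(* The value 0 for i > j makes every [F i] tame, as [wsum_sum] asks, and avoids the truncated
   subtraction j - i. *)
pose F i k := if (i <= j)%N then Z`_(j - i) * (X ^+ k)`_i else 0.
have tF i : tame (F i).
  rewrite /F; case: leqP => [ij|_]; last exact: tame_cst.
  by apply: tameZ => //; apply: tame_coef_exp => //; exact: leq_trans ij jL.
transitivity ((wsum (fun k => \sum_(i < j.+1) F i k))%:E).
  rewrite -wsumE; last exact: tame_sum.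
  rewrite /offspring_op; apply: eq_eseriesr => k _; rewrite -EFinM; congr (_ * _)%:E.
  rewrite exprD -mulrA mulrCA -/Z coefM; apply: eq_bigr => i _.
  by rewrite /F -ltnS ltn_ord mulrC.
rewrite wsum_sum// coefM; congr (_%:E); apply: eq_bigr => i _.
have ij : (i <= j)%N by rewrite -ltnS.
rewrite coef_fpol; last exact: leq_trans ij jL.
rewrite mulrC /Z -wsumZ//; last first.
  by apply: tame_coef_exp => //; exact: leq_trans ij jL.
by apply: eq_wsum => k; rewrite /F ij.
Qed.

Lemma iter_offspring_op_coef X j i c : (j <= L)%N -> jet X ->
  iter i (offspring_op a) (fun k => ((X ^+ k)`_j)%:E) c =
  ((X ^+ c * fpol X ^+ i)`_j)%:E.
Proof.
move=> jL jX; elim: i c => [|i IH] c; first by rewrite expr0 mulr1.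
rewrite iterS (funext IH) offspring_op_coef// ?exprS//.
by move=> h; apply: coef_exp_ge0 => h'; exact: coef_fpol_ge0.
Qed.

Definition jet0 (t : R) : {poly R} := t%:P * (1 + 'X).

Lemma coef_jet0 t j : (jet0 t)`_j = t * (j <= 1)%:R.
Proof.
rewrite /jet0 coefCM coefD coef1 coefX; congr (_ * _).
by rewrite -natrD; case: j => [|[|j]].
Qed.

Lemma jet_jet0 t : 0 <= t <= 1 -> jet (jet0 t).
Proof.
move=> /andP[t0 t1]; split; last by rewrite coef_jet0 mulr1.
by move=> i; rewrite coef_jet0 mulr_ge0.
Qed.

Lemma gf_tangent x y : 0 <= x <= 1 -> 0 <= y <= 1 -> gf x + dgf x * (y - x) <= gf y.
Proof.
move=> x01 y01; have [/andP[x0 x1] /andP[y0 y1]] := (x01, y01).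
have tx := tameX x01; have ty := tameX y01; have td := tame_deriv x01.
(* [wsum] is additive on nonnegative functions only, so for y < x the tangent term is moved to the
   other side of the inequality. *)
have [xy|yx] := leP x y.
  rewrite mulrC -wsumZ ?subr_ge0// -wsumD//; last by apply: tameZ; rewrite ?subr_ge0.
  apply: le_wsum => //; first by apply: tameD => //; apply: tameZ; rewrite ?subr_ge0.
  by move=> k _; rewrite [X in _ + X]mulrC; exact: expr_tangent.
have {}yx := ltW yx; suff : gf x <= gf y + (x - y) * dgf x by lra.
rewrite -wsumZ ?subr_ge0// -wsumD//; last by apply: tameZ; rewrite ?subr_ge0.
apply: le_wsum => //; first by apply: tameD => //; apply: tameZ; rewrite ?subr_ge0.
by move=> k _; have := expr_tangent k x0 y0; lra.
Qed.

(** On [0, rho] with rho < 1 the second derivative of the k-th power is at most k^2 rho^k / rho^2,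
    bounded uniformly in k: geometric decay stands in for a second moment, and the total weight is
    f(1) < 1. *)
Lemma dgf_lipschitz rho : 0 < rho < 1 -> exists2 C, 0 <= C & forall x y,
  0 <= x -> x <= y -> y <= rho -> dgf x <= dgf y <= dgf x + C * (y - x).
Proof.
move=> /andP[rho0 rho1]; have rho01 : 0 <= rho < 1 by rewrite ltW.
have [C2 C20 hC2] := natX_expr_bounded 2 rho01.
exists (C2 / rho ^+ 2) => [|x y x0 xy yrho]; first by rewrite divr_ge0// exprn_ge0// ltW.
have y0 : 0 <= y by exact: le_trans xy.
have y1 : y <= 1 by rewrite (le_trans yrho)// ltW.
have y01 : 0 <= y <= 1 by rewrite y0.
have x01 : 0 <= x <= 1 by rewrite x0 (le_trans xy).
have [tdx tdy] := (tame_deriv x01, tame_deriv y01).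
apply/andP; split.
  by apply: le_wsum => // k _; rewrite ler_wpM2l// lerXn2r.
have t1 : tame (fun k => 1 ^+ k) by apply: tameX; rewrite ler01/=.
have c0 : 0 <= C2 / rho ^+ 2 * (y - x).
  by rewrite mulr_ge0 ?subr_ge0// divr_ge0// exprn_ge0// ltW.
apply: (@le_trans _ _ (dgf x + C2 / rho ^+ 2 * (y - x) * gf 1)); last first.
  by rewrite lerD2l ler_piMr// ltW.
rewrite -wsumZ// -wsumD//; last exact: tameZ.
apply: le_wsum => //; first by apply: tameD => //; exact: tameZ.
move=> k _; rewrite expr1n mulr1.
case: k => [|[|k]]; first by rewrite !mul0r add0r.
  by rewrite /= !expr0 lerDl.
have := ler_wpM2l (ler0n R k.+2) (expr_tangent k.+1 y0 x0); rewrite /= => h.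
suff h2 : k.+2%:R * (k.+1%:R * y ^+ k * (y - x)) <= C2 / rho ^+ 2 * (y - x).
  have -> : k.+2%:R * y ^+ k.+1 = k.+2%:R * (y ^+ k.+1 + k.+1%:R * y ^+ k * (x - y)) +
    k.+2%:R * (k.+1%:R * y ^+ k * (y - x)) by ring.
  exact: lerD.
rewrite mulrA ler_wpM2r ?subr_ge0// ler_pdivlMr ?exprn_gt0//.
apply: le_trans (hC2 k.+2).
have -> : k.+2%:R ^+ 2 * rho ^+ k.+2 = k.+2%:R * (k.+2%:R * rho ^+ k) * rho ^+ 2.
  by rewrite [rho ^+ k.+2]exprS [rho ^+ k.+1]exprS; ring.
rewrite ler_wpM2r ?exprn_ge0// ?(ltW rho0)// ler_wpM2l//.
by apply: ler_pM; rewrite ?exprn_ge0 ?ler_nat// lerXn2r ?nnegrE// ltW.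
Qed.

(** The tangents at x and at y = x + h enclose f(y) - f(x) between f'(x) h and f'(y) h, so the error
    is at most |h| |f'(y) - f'(x)| <= C h^2. The bound [rho] is the midpoint of x and 1, which keeps
    y where f' is Lipschitz and [f] agrees with [gf]. *)
Lemma derive1_gf (f : R -> R) x : 0 < x < 1 ->
  (forall y, 0 <= y <= 1 -> f y = gf y) -> derive1 f x = dgf x.
Proof.
move=> /andP[x0 x1] fE; pose rho := (1 + x) / 2.
have rho01 : 0 < rho < 1 by rewrite /rho; apply/andP; split; lra.
have [C C0 hC] := dgf_lipschitz rho01.
apply: cvg_lim => //; apply/cvgrPdist_le => e e0; near=> h.
have h0 : h != 0 by near: h; exact: nbhs_dnbhs_neq.
have hx : `|h| < Num.min x ((1 - x) / 2).
  by near: h; apply: dnbhs0_lt; rewrite lt_min x0/= divr_gt0// subr_gt0.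
have he : `|h| < e / (C + 1).
  by near: h; apply: dnbhs0_lt; rewrite divr_gt0// ltr_wpDl.
move: hx; rewrite lt_min !ltr_norml => /andP[/andP[h1 h2] /andP[h3 h4]].
have y0 : 0 <= h + x by lra.
have yrho : h + x <= rho by rewrite /rho; lra.
have xrho : x <= rho by rewrite /rho; lra.
have [rho0 rho1] := andP rho01.
have y01 : 0 <= h + x <= 1 by rewrite y0/= (le_trans yrho)// ltW.
have x01 : 0 <= x <= 1 by rewrite !ltW.
rewrite !fE//; set y := h + x in y0 yrho y01 *.
have hE : h = y - x by rewrite /y addrK.
move: y hE y0 yrho y01 => y hE y0 yrho y01.
have ty := gf_tangent x01 y01; have tx := gf_tangent y01 x01.
have lip : `|dgf y - dgf x| <= C * `|h|.
  have [xy|yx] := leP x y.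
    have /andP[d1 d2] := hC _ _ (ltW x0) xy yrho.
    by rewrite hE !ger0_norm ?subr_ge0//; lra.
  have {}yx := ltW yx; have /andP[d1 d2] := hC _ _ y0 yx xrho.
  by rewrite hE !ler0_norm ?subr_le0//; lra.
have hn : 0 < `|h| by rewrite normr_gt0.
have Ce : C * `|h| <= e.
  move: he; rewrite ltr_pdivlMr; last by rewrite ltr_wpDl.
  move=> he; apply: le_trans (ltW he); rewrite mulrC ler_wpM2l// lerDl//.
apply: le_trans Ce; rewrite -(ler_pM2l hn) -normrM.
apply: (@le_trans _ _ (`|h| * `|dgf y - dgf x|)); last by rewrite ler_wpM2l.
have -> : h * (dgf x - h^-1 *: (gf y - gf x)) = - (gf y - gf x - dgf x * (y - x)).
  by rewrite -hE /GRing.scale /=; field.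
rewrite normrN ger0_norm; last by lra.
rewrite -normrM; apply: le_trans (ler_norm _); rewrite hE; lra.
Unshelve. all: by end_near. Qed.

(** * Contraction towards a fixed point of f *)

Section fixed_point.
Variable kappa : R.
Hypotheses (kappa01 : 0 <= kappa <= 1) (gf_kappa : gf kappa = kappa).

Lemma kappa_lt1 : kappa < 1.
Proof.
case/andP: kappa01 => _; rewrite le_eqVlt => /orP[/eqP k1|//].
by move: gf1_lt1; rewrite -k1 gf_kappa k1 ltxx.
Qed.

(** Slope of the chord of f between kappa and 1; it is below 1 because f(1) < 1. *)
Let theta := (gf 1 - kappa) / (1 - kappa).

Let k1_gt0 : 0 < 1 - kappa. Proof. by rewrite subr_gt0 kappa_lt1. Qed.

Let one01 : 0 <= (1 : R) <= 1. Proof. by rewrite ler01 lexx. Qed.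

Lemma secant_lt1 : theta < 1.
Proof. by rewrite ltr_pdivrMr// mul1r ltrD2r. Qed.

Lemma dgf_kappa_le : dgf kappa <= theta.
Proof.
rewrite ler_pdivlMr//; have := gf_tangent kappa01 one01.
by rewrite gf_kappa; lra.
Qed.

(** Above kappa, f stays below its chord to 1, with w the barycentric coordinate of x. Below kappa,
    f stays above its tangent at kappa, whose slope is at most that of the chord. *)
Lemma gf_contraction x : 0 <= x <= 1 -> `|gf x - kappa| <= theta * `|x - kappa|.
Proof.
move=> /andP[x0 x1]; have [k0 k1] := andP kappa01.
have [kx|xk] := leP kappa x.
  rewrite !ger0_norm ?subr_ge0//; last by rewrite -{1}gf_kappa gf_le.
  pose w := (x - kappa) / (1 - kappa).
  have w01 : 0 <= w <= 1.
    rewrite divr_ge0 ?(ltW k1_gt0) ?subr_ge0//= ler_pdivrMr// mul1r.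
    by rewrite lerD2r.
  have xE : x = (1 - w) * kappa + w by rewrite /w; field; rewrite gt_eqF.
  have w'0 : 0 <= 1 - w by rewrite subr_ge0; case/andP: w01.
  have w0 : 0 <= w by case/andP: w01.
  have : gf x <= (1 - w) * gf kappa + w * gf 1.
    rewrite -!wsumZ//; try exact: tameX.
    rewrite -wsumD; try by apply: tameZ => //; exact: tameX.
    apply: le_wsum; first by apply: tameX; rewrite x0.
      by apply: tameD; apply: tameZ => //; exact: tameX.
    by move=> k _; rewrite expr1n mulr1 xE; exact: expr_convex.
  rewrite gf_kappa => h; apply: (@le_trans _ _ (w * (gf 1 - kappa))); first by lra.
  by rewrite /w /theta le_eqVlt; apply/orP; left; apply/eqP; field; rewrite gt_eqF.
have {}xk := ltW xk; rewrite !ler0_norm ?subr_le0//; last first.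
  by rewrite -[leRHS]gf_kappa gf_le.
rewrite !opprB; have x01 : 0 <= x <= 1 by rewrite x0.
have := gf_tangent kappa01 x01; rewrite gf_kappa => h.
apply: (@le_trans _ _ (dgf kappa * (kappa - x))); first by lra.
by rewrite ler_wpM2r ?subr_ge0// dgf_kappa_le.
Qed.

Lemma gf_orbit_cvg (u : nat -> R) : 0 <= u 0%N <= 1 ->
  (forall m, u m.+1 = gf (u m)) -> u m @[m --> \oo] --> kappa.
Proof.
move=> u01 uS; have u_01 m : 0 <= u m <= 1.
  elim: m => // m /andP[um0 um1]; rewrite uS gf_ge0 ?um0//=.
  by rewrite (le_trans _ (ltW gf1_lt1))// gf_le.
apply/subr_cvg0/norm_cvg0P.
apply: (@ratio_cvg0 _ _ (fun=> theta) theta) => //.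
- by exists 0%N => // m _ /=; rewrite uS gf_contraction.
- exact: cvg_cst.
- exact: secant_lt1.
Qed.

End fixed_point.

Definition jets t m := iter m fpol (jet0 t).

(** * Asymptotics of the iterates *)

Section iteration.
Variable t : R.
Hypothesis t01 : 0 < t <= 1.

Let X := jets t.
Let x m := (X m)`_0.

Let jetX m : jet (X m).
Proof. by apply: jet_iter_fpol; apply: jet_jet0; case/andP: t01 => /ltW ->. Qed.

Let X_ge0 m j : 0 <= (X m)`_j. Proof. exact: (jetX m).1. Qed.

Let x_le1 m : x m <= 1. Proof. exact: (jetX m).2. Qed.

Let x_ge0 m : 0 <= x m. Proof. exact: X_ge0. Qed.

Let x01 m : 0 <= x m <= 1. Proof. by rewrite X_ge0 x_le1. Qed.

Let xS m : x m.+1 = gf (x m). Proof. by rewrite /x /X /jets /= coef0_fpol. Qed.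

Let xS_le m : x m.+1 <= gf 1.
Proof. by rewrite xS; apply: gf_le; rewrite ?X_ge0. Qed.

Let XS m j : (j <= L)%N -> (X m.+1)`_j = wsum (fun k => (X m ^+ k)`_j).
Proof. by move=> jL; rewrite /X /jets /= coef_fpol. Qed.

Let coef_exp_ge m k j : (X m)`_j * x m ^+ k <= (X m ^+ k.+1)`_j.
Proof.
rewrite exprSr coefMr big_ord_recr /= subnn coef0_exp mulrC lerDr.
by apply: sumr_ge0 => i _; rewrite mulr_ge0// coef_exp_ge0.
Qed.

Hypothesis branching : exists2 k, (2 <= k)%N & 0 < a k.

(** [jet0] has degree one, and an index k >= 2 of positive weight lets two factors share the degree,
    so at least one more coefficient becomes positive at each step. The norming constants are thus
    positive for large m. *)
Lemma iter_fpol_gt0 m j : (j <= m.+1)%N -> (j <= L)%N -> 0 < (X m)`_j.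
Proof.
have [k k2 ak] := branching; have t0 : 0 < t by case/andP: t01.
elim: m j => [|m IH] j jm jL; first by rewrite /X /jets /= coef_jet0 jm mulr1.
rewrite XS//; apply: lt_le_trans (wsum_term k (tame_coef_exp jL (jetX m))).
rewrite pmulr_rgt0//; case: k k2 {ak} => [|[|k]]// _.
have [j1 [j2 [jE j1m j2m]]] : exists j1 j2, [/\ j = (j1 + j2)%N, (j1 <= m.+1)%N & (j2 <= m.+1)%N].
  by exists (minn j m.+1), (j - minn j m.+1)%N; split; lia.
have j1L : (j1 <= L)%N by lia.
have j2L : (j2 <= L)%N by lia.
have j1j : (j1 < j.+1)%N by lia.
rewrite exprS coefM (bigD1 (Ordinal j1j))//=.
rewrite ltr_wpDr//; first by apply: sumr_ge0 => i _; rewrite mulr_ge0// coef_exp_ge0.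
rewrite pmulr_rgt0 ?IH// (_ : (j - j1)%N = j2); last by lia.
apply: lt_le_trans (coef_exp_ge m k j2).
by rewrite pmulr_rgt0 ?IH// exprn_gt0// IH.
Qed.

Let x_gt0 m : 0 < x m. Proof. exact: iter_fpol_gt0. Qed.

Variable l : nat.
Hypothesis lL : (l <= L)%N.

Let B0 := wsum (fun k => k.+1%:R ^+ L).

Let tame_B0 : tame (fun k => k.+1%:R ^+ L).
Proof. by exists 1 => k; rewrite mul1r exprn_ge0/=. Qed.

Let natX_le k j : (j <= L)%N -> k%:R ^+ j <= k.+1%:R ^+ L :> R.
Proof.
move=> jL; apply: (@le_trans _ _ (k.+1%:R ^+ j)).
  by rewrite lerXn2r ?nnegrE// ler_nat.
by apply: ler_weXn2l => //; rewrite ler1n.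
Qed.

Let B0_ge0 : 0 <= B0. Proof. exact: wsum_ge0. Qed.

(** * Positive minimal offspring number: the orbit tends to 0 *)

Section minimal_offspring.
Variable r : nat.
Hypotheses (r_gt0 : (0 < r)%N) (ar : 0 < a r) (a_lt_r : forall k, (k < r)%N -> a k = 0).

Let ge_r k : a k != 0 -> (r <= k)%N.
Proof. by case: leqP => // /a_lt_r ->; rewrite eqxx. Qed.

Let gf_ge y : 0 <= y <= 1 -> a r * y ^+ r <= gf y.
Proof. by move=> y01; exact: wsum_term (tameX y01). Qed.

Let tame1 : tame (fun k => 1 ^+ k).
Proof. by apply: tameX; rewrite ler01/=. Qed.

Let gf_le1 y : 0 <= y <= 1 -> gf y <= y ^+ r * gf 1.
Proof.
move=> /andP[y0 y1]; rewrite -wsumZ ?exprn_ge0//.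
apply: le_wsum; first exact/tameX/andP.
  by apply: tameZ; [exact: exprn_ge0|apply: tameX; rewrite ler01/=].
by move=> k /ge_r rk; rewrite expr1n mulr1; apply: ler_wiXn2l.
Qed.

(** The term k = r is kept exactly; each later one has at least one more factor y, and the total
    moment [B0] bounds what remains. *)
Let wsum_natX_le y j : (j <= L)%N -> 0 <= y <= 1 ->
  wsum (fun k => y ^+ k * k%:R ^+ j) <= a r * (y ^+ r * r%:R ^+ j) + y ^+ r.+1 * B0.
Proof.
move=> jL /andP[y0 y1]; have y01 : 0 <= y <= 1 by rewrite y0.
have tg := tame_XnatX jL y01; have yr0 : 0 <= y ^+ r.+1 by exact: exprn_ge0.
rewrite -(wsum_single r tg) -wsumZ// -wsumD//; last first.
- by apply: tameZ.
- exact: (tame_single r tg).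
apply: le_wsum => //; first by apply: tameD; [exact: (tame_single r tg)|by apply: tameZ].
move=> k /ge_r; rewrite leq_eqVlt => /orP[/eqP <-|rk].
  by rewrite eqxx lerDl mulr_ge0// exprn_ge0.
rewrite gtn_eqF// add0r; apply: ler_pM; rewrite ?exprn_ge0 ?natX_le//.
exact: ler_wiXn2l.
Qed.

Let gf_le2 y : 0 <= y <= 1 -> gf y <= a r * y ^+ r * (1 + y / a r).
Proof.
move=> /andP[y0 y1]; have y01 : 0 <= y <= 1 by rewrite y0.
have tg := tameX y01; have yr0 : 0 <= y ^+ r.+1 by exact: exprn_ge0.
apply: (@le_trans _ _ (a r * y ^+ r + y ^+ r.+1 * gf 1)).
  rewrite -(wsum_single r tg) -wsumZ//.
  rewrite -wsumD//; last first.
  - by apply: tameZ => //; exact: tame1.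
  - exact: (tame_single r tg).
  apply: le_wsum => //.
    by apply: tameD; [exact: (tame_single r tg)|by apply: tameZ => //; exact: tame1].
  move=> k /ge_r; rewrite leq_eqVlt expr1n mulr1 => /orP[/eqP <-|rk].
    by rewrite eqxx lerDl.
  by rewrite gtn_eqF// add0r; exact: ler_wiXn2l.
apply: (@le_trans _ _ (a r * y ^+ r + y ^+ r.+1)).
  by rewrite lerD2l ler_piMr// ltW.
rewrite exprSr le_eqVlt; apply/orP; left; apply/eqP.
by field; rewrite gt_eqF.
Qed.

Let B := B0 / a r.
Let B_ge0 : 0 <= B. Proof. by rewrite divr_ge0// ltW. Qed.

Fixpoint growth m : R :=
  if m is m'.+1 then growth m' * (r%:R * (1 + B * x m')) else 1.

Let growth_ge1 m : 1 <= growth m.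
Proof.
elim: m => //= m IH; apply: mulr_ege1 => //; apply: mulr_ege1; first by rewrite ler1n.
by rewrite lerDl mulr_ge0.
Qed.

Let growth_ge0 m : 0 <= growth m. Proof. exact: le_trans (growth_ge1 m). Qed.

(* After division by [x m], the coefficient of index j grows by a factor of at most
   (r (1 + B x_m))^j at each step: only the term k = r of the generating function matters. *)
Let coef_le_growth m j : (j <= L)%N -> (X m)`_j <= x m * growth m ^+ j.
Proof.
elim: m j => [|m IH] j jL.
  rewrite /x /X /jets /= !coef_jet0 expr1n mulr1 /= mulr1 ler_piMr//.
    by case/andP: t01 => /ltW.
  by rewrite lern1 leq_b1.
case: j jL => [_|j jL]; first by rewrite expr0 mulr1.
rewrite XS//; apply: (@le_trans _ _ (growth m ^+ j.+1 * wsum (fun k => x m ^+ k * k%:R ^+ j.+1))).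
  rewrite -wsumZ ?exprn_ge0//; last exact: tame_XnatX.
  apply: le_wsum; first exact: tame_coef_exp.
    by apply: tameZ; [exact: exprn_ge0|exact: tame_XnatX].
  move=> k _; rewrite mulrCA -exprMn; apply: coef_exp_le => //.
  by move=> i ij; apply: IH; exact: leq_trans ij jL.
rewrite /= exprMn mulrCA ler_wpM2l ?exprn_ge0//.
apply: (le_trans (wsum_natX_le jL (x01 m))).
apply: (@le_trans _ _ (a r * x m ^+ r * (r%:R * (1 + B * x m)) ^+ j.+1)); last first.
  by rewrite xS ler_wpM2r ?gf_ge// exprn_ge0// mulr_ge0// addr_ge0// mulr_ge0.
have -> : x m ^+ r.+1 * B0 = a r * x m ^+ r * (B * x m).
  by rewrite exprSr /B; field; rewrite gt_eqF.
rewrite [a r * (_ * _)]mulrA -mulrDr ler_wpM2l ?mulr_ge0 ?exprn_ge0// exprMn.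
have r1 : 1 <= r%:R ^+ j.+1 :> R by rewrite exprn_ege1// ler1n.
have bx : 0 <= B * x m by rewrite mulr_ge0.
have b1 : 1 <= (1 + B * x m) by rewrite lerDl.
apply: (@le_trans _ _ (r%:R ^+ j.+1 * (1 + B * x m))).
  by rewrite mulrDr mulr1 lerD2l ler_peMl.
by rewrite ler_wpM2l ?exprn_ge0// exprS ler_peMr// ?exprn_ege1// (le_trans _ b1).
Qed.

(* [v m] bounds W_m(N + 1) / W_m(N) up to a constant, and [v m.+1 <= h (x m) * v m] with
   [h 0 < 1]. *)
Let h y : R := gf 1 * y ^+ r.-1 * (1 + y / a r) * (r%:R * (1 + B * y)) ^+ l.

Let v m := x m ^+ 2 * growth m ^+ l / (X m)`_l.

Let v_ge0 m : 0 <= v m.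
Proof. by rewrite divr_ge0// mulr_ge0// exprn_ge0. Qed.

Let gf1_ge0 : 0 <= gf 1. Proof. by apply: gf_ge0; rewrite ler01 lexx. Qed.

Let h_ge0 y : 0 <= y -> 0 <= h y.
Proof.
move=> y0; have By : 0 <= 1 + B * y by rewrite addr_ge0// mulr_ge0.
have ay : 0 <= 1 + y / a r by rewrite addr_ge0// divr_ge0.
apply: mulr_ge0; last by rewrite exprn_ge0// mulr_ge0.
by apply: mulr_ge0 => //; rewrite mulr_ge0// exprn_ge0.
Qed.

(** The two factors x_{m+1} of the numerator are bounded differently: [gf_le2] brings an a_r that
    cancels the one from the term k = r below, and [gf_le1] brings the factor f(1), which decides
    the case r = 1. *)
Let vS m : 0 < (X m)`_l -> v m.+1 <= h (x m) * v m.
Proof.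
move=> Xl; have x0 := x_gt0 m.
have Xl' : a r * x m ^+ r.-1 * (X m)`_l <= (X m.+1)`_l.
  rewrite XS//; apply: le_trans (wsum_term r (tame_coef_exp lL (jetX m))).
  rewrite -mulrA ler_wpM2l// mulrC -[in leRHS](prednK r_gt0).
  exact: coef_exp_ge.
have d0 : 0 < a r * x m ^+ r.-1 * (X m)`_l by rewrite !mulr_gt0// exprn_gt0.
rewrite /v ler_pdivrMr; last exact: lt_le_trans Xl'.
apply: (@le_trans _ _ (h (x m) * (x m ^+ 2 * growth m ^+ l / (X m)`_l) *
   (a r * x m ^+ r.-1 * (X m)`_l))); last first.
  by rewrite ler_wpM2l// mulr_ge0 ?h_ge0//; exact: v_ge0.
have -> : h (x m) * (x m ^+ 2 * growth m ^+ l / (X m)`_l) * (a r * x m ^+ r.-1 * (X m)`_l) =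
   (x m ^+ r * gf 1) * (a r * x m ^+ r * (1 + x m / a r)) * growth m.+1 ^+ l.
  rewrite /h /= [(growth m * _) ^+ l]exprMn.
  have -> : x m ^+ r = x m * x m ^+ r.-1 by rewrite -exprS prednK.
  move: (x m ^+ r.-1) (_ ^+ l) (growth m ^+ l) => e1 e2 e3.
  by field; rewrite !gt_eqF.
rewrite ler_wpM2r ?exprn_ge0// expr2 xS.
by apply: ler_pM; rewrite ?gf_ge0// ?gf_le1// gf_le2.
Qed.

Let x_geo m : x m <= 1 * gf 1 ^+ m.
Proof.
elim: m => [|m IH]; first by rewrite expr0 mulr1.
rewrite xS (le_trans (gf_le1 (x01 m)))// exprSr mul1r ler_wpM2r//.
rewrite mul1r in IH; apply: le_trans IH.
by rewrite -[leRHS]expr1; apply: ler_wiXn2l.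
Qed.

Lemma min_x_cvg0 : x m @[m --> \oo] --> 0.
Proof. by apply: geometric_cvg0 x_geo => //; rewrite gf1_ge0. Qed.

Lemma min_v_cvg0 : v m @[m --> \oo] --> 0.
Proof.
apply: (@ratio_cvg0 _ v (fun m => h (x m)) (h 0)) => //.
- by exists l => // m /= lm; apply: vS; apply: iter_fpol_gt0 => //; rewrite leqW.
- rewrite /h; apply: cvgM.
    apply: cvgM.
      by apply: cvgM; [exact: cvg_cst|exact: cvgn_expr min_x_cvg0].
    by apply: cvgD; [exact: cvg_cst|apply: cvgM; [exact: min_x_cvg0|exact: cvg_cst]].
  apply: cvgn_expr.
  apply: cvgM; first exact: cvg_cst.
  apply: cvgD; first exact: cvg_cst.
  by apply: cvgM; [exact: cvg_cst|exact: min_x_cvg0].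
(* For r = 1 the convention 0^0 = 1 leaves h 0 = f(1) < 1; for r >= 2 the power 0^(r-1) vanishes. *)
- rewrite /h mul0r addr0 !mulr1 mulr0 addr0 mulr1.
  have [->|r1] := eqVneq r 1%N; first by rewrite /= expr0 mulr1 expr1n mulr1.
  by rewrite expr0n (_ : r.-1 == 0%N = false) ?mulr0 ?mul0r//; lia.
Qed.

Lemma min_ratio_cvg N : (0 < N)%N ->
  (exists C, \forall m \near \oo, 0 < (X m ^+ N)`_l /\
    forall k, (N <= k)%N -> (X m ^+ k)`_l / (X m ^+ N)`_l <= C) /\
  forall k, (N <= k)%N ->
    (X m ^+ k)`_l / (X m ^+ N)`_l @[m --> \oo] --> ((k == N)%:R : R).
Proof.
move=> N0.
have XlN m : (l <= m)%N -> 0 < (X m)`_l * x m ^+ N.-1 /\ (X m)`_l * x m ^+ N.-1 <= (X m ^+ N)`_l.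
  move=> lm; split; first by rewrite mulr_gt0 ?exprn_gt0 ?x_gt0// iter_fpol_gt0// leqW.
  by rewrite -[N in X m ^+ N](prednK N0) coef_exp_ge.
(* The numerator is at most x^k (growth k)^l and the denominator at least X_l x^(N-1). The quotient
   leaves x^(k-N+1), whose factor x^2 goes into [v]. *)
have main m k : (l <= m)%N -> (N < k)%N ->
    (X m ^+ k)`_l / (X m ^+ N)`_l <= v m * (k%:R ^+ l * x m ^+ (k - N.+1)).
  move=> lm Nk; have [d0 dle] := XlN _ lm.
  rewrite ler_pdivrMr; last exact: lt_le_trans dle.
  apply: (le_trans (coef_exp_le k (X_ge0 m 0) (growth_ge0 m) (X_ge0 m) _)).
    by move=> i il; apply: coef_le_growth; exact: leq_trans il lL.
  apply: (@le_trans _ _ (v m * (k%:R ^+ l * x m ^+ (k - N.+1)) * ((X m)`_l * x m ^+ N.-1))); last first.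
    by rewrite ler_wpM2l// mulr_ge0 ?v_ge0// mulr_ge0// exprn_ge0.
  have Xl : 0 < (X m)`_l by rewrite iter_fpol_gt0// leqW.
  rewrite /v exprMn -/(x m) -{1}(subnK Nk) -[N in (_ + N.+1)%N](prednK N0).
  rewrite addnS addnS 2!exprSr exprD le_eqVlt; apply/orP; left; apply/eqP.
  by field; rewrite gt_eqF.
have g0 : 0 <= gf 1 < 1 by rewrite gf1_ge0.
have [C C0 hC] := natX_expr_bounded l g0.
split.
  (* The 1 serves k = N. For k > N, x_m <= f(1) as soon as m > 0, and C bounds k^l f(1)^k. *)
  exists (Num.max 1 (C / gf 1 ^+ N.+1)); near=> m.
  have lm : (l <= m)%N by near: m; exists l.
  have m0 : (0 < m)%N by near: m; exists 1%N.
  have [d0 dle] := XlN _ lm.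
  split; first exact: lt_le_trans dle.
  move=> k; rewrite leq_eqVlt => /orP[/eqP <-|Nk].
    by rewrite divff ?gt_eqF ?le_max ?lexx//; exact: lt_le_trans dle.
  rewrite le_max; apply/orP; right; apply: (le_trans (main _ _ lm Nk)).
  have v1 : v m <= 1.
    by near: m; apply: (cvgr_le _ min_v_cvg0); exact: ltr01.
  apply: (@le_trans _ _ (1 * (k%:R ^+ l * gf 1 ^+ (k - N.+1)))).
    apply: ler_pM => //; first by rewrite mulr_ge0// exprn_ge0.
    rewrite ler_wpM2l ?exprn_ge0// lerXn2r ?nnegrE//.
    by rewrite -[m]prednK// xS_le.
  have gf1_gt0 : 0 < gf 1 by apply: lt_le_trans (gf_ge _); rewrite ?expr1n ?mulr1// ler01 lexx.
  rewrite mul1r ler_pdivlMr ?exprn_gt0// -mulrA -exprD subnK//.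
move=> k; rewrite leq_eqVlt => /orP[/eqP <-|Nk].
  rewrite eqxx; apply: cvg_near_cst; exists l => // m /= /XlN[d0 dle].
  by rewrite divff// gt_eqF//; exact: lt_le_trans dle.
rewrite gtn_eqF//; apply: (@squeeze_cvgr _ _ _ _ (fun=> 0) (fun m => v m * k%:R ^+ l)).
- near=> m; have lm : (l <= m)%N by near: m; exists l.
  rewrite divr_ge0 ?coef_exp_ge0//=; apply: (le_trans (main _ _ lm Nk)).
  by rewrite ler_wpM2l ?v_ge0// ler_piMr ?exprn_ge0// exprn_ile1.
- exact: cvg_cst.
- have h1 : v m * k%:R ^+ l @[m --> \oo] --> (0 * k%:R ^+ l : R).
    by apply: cvgM; [exact: min_v_cvg0|exact: cvg_cst].
  by rewrite mul0r in h1.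
Unshelve. all: by end_near. Qed.

End minimal_offspring.

(** * Minimal offspring number 0: the orbit tends to kappa *)

Section positive_extinction.
Variable kappa : R.
Hypotheses (a0_gt0 : 0 < a 0%N) (kappa01 : 0 <= kappa <= 1)
  (gf_kappa : gf kappa = kappa) (l_gt0 : (0 < l)%N).

Let y m := (X m)`_1.

Let yS m : y m.+1 = dgf (x m) * y m.
Proof. exact: coef1_fpol. Qed.

Let y_gt0 m : 0 < y m. Proof. exact: iter_fpol_gt0. Qed.

Let a0_le_x m : (0 < m)%N -> a 0%N <= x m.
Proof.
case: m => // m _; rewrite xS -[leLHS]mulr1 -(expr0 (x m)).
exact: wsum_term (tameX (x01 m)).
Qed.

Let x_cvg : x m @[m --> \oo] --> kappa.
Proof. by apply: gf_orbit_cvg => //; exact: x01. Qed.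

Let x_lt1 m : (0 < m)%N -> x m < 1.
Proof. by case: m => // m _; exact: le_lt_trans (xS_le m) _. Qed.

(** By convexity f'(x_m) is at most the slope of the chord from x_m to 1, and these slopes converge
    to that from kappa. Only m > 0 is used, since x_0 = t may be 1. *)
Lemma coef1_geometric : exists theta C, [/\ 0 < theta < 1, 0 <= C &
  forall m, y m <= C * theta ^+ m].
Proof.
apply: (@ratio_geometric _ y (fun m => (gf 1 - x m.+1) / (1 - x m))
  ((gf 1 - kappa) / (1 - kappa))).
- by move=> m; exact: ltW.
- exists 1%N => // m /= m0; rewrite yS ler_wpM2r ?(ltW (y_gt0 m))//.
  have x1 : 0 < 1 - x m by rewrite subr_gt0 x_lt1.
  rewrite ler_pdivlMr// xS.
  have := @gf_tangent (x m) 1 (x01 m); rewrite ler01 lexx => /(_ isT); lra.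
- apply: cvgM.
    apply: cvgB; first exact: cvg_cst.
    by rewrite (cvg_shiftS x).
  apply: cvgV; last by apply: cvgB; [exact: cvg_cst|exact: x_cvg].
  by rewrite gt_eqF// subr_gt0 kappa_lt1.
- exact: secant_lt1.
Qed.

Let y_cvg0 : y m @[m --> \oo] --> 0.
Proof.
have [theta [C [/andP[th0 th1] C0 hC]]] := coef1_geometric.
by apply: (geometric_cvg0 _ _ hC) => [m|]; [exact: ltW|rewrite th1 ltW].
Qed.

(** A lower bound on y_{m+1} / y_m, by which errors of order y_m^2 can be divided. It holds since
    the orbit stays above a_0 after the first step. *)
Let dgf_gt0 : exists2 mu, 0 < mu & forall m, (0 < m)%N -> mu <= dgf (x m).
Proof.
have [k k2 ak] := branching; exists (a k * (k%:R * a 0%N ^+ k.-1)).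
  by rewrite !mulr_gt0 ?exprn_gt0// ltr0n ltnW.
move=> m m0; apply: le_trans (wsum_term k (tame_deriv (x01 m))).
rewrite ler_wpM2l// ler_wpM2l// lerXn2r ?nnegrE//.
exact: a0_le_x.
Qed.

Let m0_ex : exists m0, [/\ (0 < m0)%N, (l <= m0)%N & forall m, (m0 <= m)%N -> y m <= 1].
Proof.
have [N _ hN] : \forall m \near \oo, y m <= 1.
  by apply: (cvgr_le _ y_cvg0); exact: ltr01.
exists (maxn N l.+1); split; [by lia|by lia|move=> m hm; apply: hN => /=; lia].
Qed.

(* [z m.+1 <= z m + O(y m)] for the ratio z of the coefficient of index j to y, because both
   are multiplied by f'(x_m) up to an error O(y_m^2). *)
Lemma coef_le_coef1 m0 j : (0 < m0)%N -> (forall m, (m0 <= m)%N -> y m <= 1) ->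
  (j <= L)%N -> exists2 K, 1 <= K & forall m i, (m0 <= m)%N -> (0 < i <= j)%N ->
    (X m)`_i <= x m * y m * K ^+ i.
Proof.
move=> m0_gt0 y1; elim: j => [|j IH] jL.
  by exists 1 => // m i _ /andP[]; case: i.
have [K K1 hK] := IH (ltnW jL); have K0 : 0 <= K by exact: le_trans K1.
have [theta [C [th01 C0 hC]]] := coef1_geometric.
have [mu mu0 hmu] := dgf_gt0.
pose z m := (X m)`_j.+1 / y m.
have yy m : 0 <= y m by exact: ltW.
(* An error y_m^2 K^(j+1) B0 divided by y_{m+1} >= mu y_m leaves y_m K^(j+1) B0 / mu, and y_m <= C
   theta^m. *)
pose c := C * (K ^+ j.+1 * B0) / mu.
have zS m : (m0 <= m)%N -> z m.+1 <= z m + c * theta ^+ m.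
  move=> m0m; have mm : (0 < m)%N by exact: leq_trans m0m.
  have dpos : 0 < dgf (x m) by exact: lt_le_trans (hmu _ mm).
  have hX : (X m.+1)`_j.+1 <= dgf (x m) * (X m)`_j.+1 + y m ^+ 2 * (K ^+ j.+1 * B0).
    rewrite XS// [X in X + _]mulrC.
    rewrite -wsumZ//; last exact: tame_deriv.
    have KB : 0 <= K ^+ j.+1 by exact: exprn_ge0.
    have y2 : 0 <= y m ^+ 2 by exact: exprn_ge0.
    rewrite -wsumZ// -wsumZ//; last exact: tameZ.
    rewrite -wsumD; last 2 first.
    - by apply: tameZ => //; exact: tame_deriv.
    - by apply: tameZ => //; exact: tameZ.
    apply: le_wsum; first exact: tame_coef_exp.
      by apply: tameD; apply: tameZ => //; [exact: tame_deriv|exact: tameZ].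
    move=> k _.
    have hy : 0 <= y m <= 1 by rewrite yy y1.
    have hX i : (0 < i < j.+1)%N -> (X m)`_i <= x m * y m * K ^+ i.
      by move=> /andP[i0 ij]; apply: hK => //; rewrite i0.
    have /andP[_ h] := coef_exp_linear k hy K0 (ltn0Sn j) (X_ge0 m) hX.
    apply: (le_trans h).
    rewrite [(X m)`_j.+1 * _]mulrC lerD2l exprMn.
    apply: (@le_trans _ _ (1 * y m ^+ 2 * (K ^+ j.+1 * k%:R ^+ j.+1))).
      rewrite -!mulrA; apply: ler_wpM2r; first by rewrite !mulr_ge0// exprn_ge0.
      by apply: exprn_ile1; [exact: X_ge0|exact: x_le1].
    by rewrite mul1r ler_wpM2l// ler_wpM2l// natX_le.
  rewrite /z yS ler_pdivrMr; last by rewrite mulr_gt0.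
  apply: (le_trans hX).
  have -> : ((X m)`_j.+1 / y m + c * theta ^+ m) * (dgf (x m) * y m) =
     dgf (x m) * (X m)`_j.+1 + c * theta ^+ m * (dgf (x m) * y m).
    by field; rewrite gt_eqF.
  rewrite lerD2l expr2 -mulrA mulrCA [leRHS]mulrA [leRHS]mulrC ler_wpM2l//.
  apply: (@le_trans _ _ (C * theta ^+ m * (K ^+ j.+1 * B0))).
    by rewrite ler_wpM2r// mulr_ge0// exprn_ge0.
  apply: (@le_trans _ _ (c * theta ^+ m * mu)).
    by rewrite /c le_eqVlt; apply/orP; left; apply/eqP; field; rewrite gt_eqF.
  case/andP: th01 => th0 _.
  by rewrite ler_wpM2l ?hmu// mulr_ge0 ?exprn_ge0 ?(ltW th0)// /c divr_ge0 ?(ltW mu0)// !mulr_ge0// exprn_ge0.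
have c0 : 0 <= c by rewrite /c divr_ge0 ?(ltW mu0)// !mulr_ge0// exprn_ge0.
pose D := z m0 + c * theta ^+ m0 / (1 - theta).
have hD m : (m0 <= m)%N -> z m <= D.
  by move=> m0m; exact: (geometric_increments_bounded th01 zS m0m c0).
have D0 : 0 <= D.
  by apply: le_trans (hD _ (leqnn _)); rewrite /z divr_ge0.
have Da : 0 <= D / a 0%N by rewrite divr_ge0.
(* The bound D y_m lacks the factor x_m; it is restored by D = a_0 (D / a_0) and a_0 <= x_m. *)
exists (K + D / a 0%N); first by rewrite (le_trans K1)// lerDl.
move=> m i m0m /andP[i0]; rewrite leq_eqVlt => /orP[/eqP ->|ij].
  have mm : (0 < m)%N by exact: leq_trans m0m.
  apply: (@le_trans _ _ (D * y m)); first by rewrite -ler_pdivrMr//; exact: hD.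
  rewrite [leRHS]mulrAC ler_wpM2r//.
  apply: (@le_trans _ _ (a 0%N * (D / a 0%N))).
    by rewrite mulrC divfK// gt_eqF.
  apply: ler_pM => //; [exact: a0_le_x|].
  apply: (@le_trans _ _ (K + D / a 0%N)); first by rewrite lerDr.
  rewrite exprS ler_peMr ?addr_ge0// exprn_ege1// (le_trans K1)// lerDl//.
apply: (le_trans (hK m i m0m _)); first by rewrite i0.
by rewrite ler_wpM2l ?mulr_ge0// lerXn2r ?nnegrE ?addr_ge0// lerDl.
Qed.

(** Apart from the linear term, the coefficient of index l in X_m^k is O(y_m^2), while that of X_m
    is at least a multiple of y_m; the quotient has error O(y_m). *)
Lemma coef_ratio_cvg :
  (exists C, \forall m \near \oo, 0 < (X m)`_l /\
    forall k, (X m ^+ k)`_l / (X m)`_l <= C) /\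
  forall k, (X m ^+ k)`_l / (X m)`_l @[m --> \oo] -->
    (k%:R * kappa ^+ k.-1 : R).
Proof.
have [m0 [m0_gt0 lm0 y1]] := m0_ex.
have [K K1 hK] := coef_le_coef1 m0_gt0 y1 lL.
have K0 : 0 <= K by exact: le_trans K1.
have yy m : 0 <= y m by exact: ltW.
have lin m k : (m0 <= m)%N ->
    k%:R * x m ^+ k.-1 * (X m)`_l <= (X m ^+ k)`_l <=
    k%:R * x m ^+ k.-1 * (X m)`_l + x m ^+ k * y m ^+ 2 * (K * k%:R) ^+ l.
  move=> m0m; apply: coef_exp_linear => //; first by rewrite yy y1.
  by move=> i /andP[i0 il]; apply: hK => //; rewrite i0 ltnW.
have Xl m : (m0 <= m)%N -> 0 < (X m)`_l.
  by move=> m0m; apply: iter_fpol_gt0 => //; lia.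
(* The ratio of the coefficient of index l to y cannot fall below its value at m0: y is multiplied
   by f'(x_m), and the other coefficient by at least that. *)
pose b := (X m0)`_l / y m0.
have b0 : 0 < b by rewrite divr_gt0// Xl.
have Xb m : (m0 <= m)%N -> b * y m <= (X m)`_l.
  elim: m => [|m IH]; first by rewrite leqn0 => /eqP e; rewrite /b e divfK// gt_eqF.
  rewrite leq_eqVlt => /orP[/eqP <-|]; first by rewrite /b divfK// gt_eqF.
  rewrite ltnS => m0m; rewrite yS XS//.
  apply: (@le_trans _ _ (dgf (x m) * (X m)`_l)).
    by rewrite mulrCA ler_wpM2l ?IH//; apply: wsum_ge0; exact: tame_deriv.
  rewrite mulrC -wsumZ//; last exact: tame_deriv.
  apply: le_wsum; [by apply: tameZ => //; exact: tame_deriv|exact: tame_coef_exp|].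
  by move=> k _; rewrite mulrC; case/andP: (lin m k m0m).
have up m k : (m0 <= m)%N -> (X m ^+ k)`_l / (X m)`_l <=
    k%:R * x m ^+ k.-1 + x m ^+ k * k%:R ^+ l * (K ^+ l / b) * y m.
  move=> m0m; rewrite ler_pdivrMr ?Xl//; have /andP[_ h] := lin m k m0m.
  apply: (le_trans h); rewrite mulrDl lerD2l.
  apply: (@le_trans _ _ (x m ^+ k * k%:R ^+ l * (K ^+ l / b) * y m * (b * y m))).
    by rewrite exprMn le_eqVlt; apply/orP; left; apply/eqP; field; rewrite gt_eqF.
  by rewrite ler_wpM2l ?Xb// !mulr_ge0 ?exprn_ge0// invr_ge0 ltW.
have low m k : (m0 <= m)%N -> k%:R * x m ^+ k.-1 <= (X m ^+ k)`_l / (X m)`_l.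
  by move=> m0m; rewrite ler_pdivlMr ?Xl//; case/andP: (lin m k m0m).
have gf1_gt0 : 0 < gf 1.
  by apply: lt_le_trans a0_gt0 _; apply: le_trans (a0_le_x (ltn0Sn 0)) (xS_le _).
have g01 : 0 <= gf 1 < 1 by rewrite ltW.
have [C C0 hC] := natX_expr_bounded l g01.
have [C1 C10 hC1] := natX_expr_bounded 1 g01.
split.
  exists (C1 / gf 1 + C * (K ^+ l / b)); exists m0 => // m /= m0m.
  split; [exact: Xl|move=> k]; apply: (le_trans (up _ _ m0m)).
  have xg : x m <= gf 1 by rewrite -[m]prednK ?xS_le//; exact: leq_trans m0m.
  apply: lerD.
    rewrite ler_pdivlMr//; apply: le_trans (hC1 k); rewrite expr1.
    case: k => [|k]; first by rewrite !mul0r.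
    rewrite /= exprSr mulrA ler_wpM2r ?(ltW gf1_gt0)// ler_wpM2l// lerXn2r ?nnegrE//.
    exact: ltW.
  rewrite -[leRHS]mulr1; apply: ler_pM; rewrite ?yy ?y1//.
    by rewrite !mulr_ge0 ?exprn_ge0// invr_ge0 ltW.
  rewrite ler_wpM2r ?divr_ge0 ?exprn_ge0 ?(ltW b0)//; apply: le_trans (hC k).
  by rewrite mulrC ler_wpM2l ?exprn_ge0// lerXn2r ?nnegrE// ltW.
move=> k; have lc : k%:R * x m ^+ k.-1 @[m --> \oo] --> (k%:R * kappa ^+ k.-1 : R).
  by apply: cvgM; [exact: cvg_cst|exact: cvgn_expr].
apply: (@squeeze_cvgr _ _ _ _ (fun m => k%:R * x m ^+ k.-1)
  (fun m => k%:R * x m ^+ k.-1 + x m ^+ k * k%:R ^+ l * (K ^+ l / b) * y m)) => //.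
  by exists m0 => // m /= m0m; rewrite low//= up.
have h : k%:R * x m ^+ k.-1 + x m ^+ k * k%:R ^+ l * (K ^+ l / b) * y m @[m --> \oo] -->
   (k%:R * kappa ^+ k.-1 + kappa ^+ k * k%:R ^+ l * (K ^+ l / b) * 0 : R).
  apply: cvgD => //; apply: cvgM => //; apply: cvgM; last exact: cvg_cst.
  by apply: cvgM; [exact: cvgn_expr|exact: cvg_cst].
by rewrite mulr0 addr0 in h.
Qed.

End positive_extinction.
End iteration.
End weighted_sums.

(** * The limits of the ratios *)

Section setup.
Context {R : realType}.

Lemma hilbert_nat l k : (hilbert R l).[k%:R] = 'C(k, l)%:R.
Proof.
rewrite /hilbert hornerZ horner_prod.
have -> : \prod_(j < l) ('X - (j%:R)%:P).[k%:R] = (k ^_ l)%:R :> R.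
  elim: l => [|l IH]; first by rewrite big_ord0 ffactn0.
  rewrite big_ord_recr /= IH !hornerE ffactnSr natrM.
  have [lk|kl] := leqP l k; first by rewrite natrB.
  by rewrite ffact_small// !mul0r.
by rewrite -bin_ffact natrM mulrC mulfK// pnatr_eq0 -lt0n fact_gt0.
Qed.

Lemma hilbert_jet0 l k (t : R) :
  (hilbert R l).[k%:R] * t ^+ k = (jet0 t ^+ k)`_l.
Proof.
rewrite hilbert_nat /jet0 exprMn -polyC_exp coefCM mulrC; congr (_ * _).
rewrite exprDn coef_sum; under eq_bigr do rewrite expr1n mul1r coefMn coefXn.
have [lk|kl] := ltnP l k.+1.
  rewrite (bigD1 (Ordinal lk))//= eqxx big1 ?addr0// => i il.
  rewrite (_ : (l == i) = false) ?mul0rn//; apply/negbTE; apply: contra il => /eqP li.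
  by apply/eqP/val_inj.
rewrite bin_small// big1// => i _; rewrite (_ : (l == i) = false) ?mul0rn//.
by apply/negbTE; rewrite gtn_eqF// (leq_trans (ltn_ord i)).
Qed.

Variables (p q : nat -> R) (l : nat) (s : R).
Hypotheses (hp : offspring_distribution p) (hmean : has_moment p 1)
  (hmom : has_moment p l) (hq : mark_function q)
  (hpq : exists k, 0 < p k * q k) (hs : 0 < s < 1).

(** Order l serves H_l, and order 1 serves f', also when l = 0. *)
Let L := maxn 1 l.
Let a k := alpha p q k s.
Let p_ge0 k : 0 <= p k. Proof. exact: hp.1. Qed.
Let s_ge0 : 0 <= s. Proof. by case/andP: hs => /ltW. Qed.
Let s_le1 : s <= 1. Proof. by case/andP: hs => _ /ltW. Qed.

Lemma offspring_moment : (\sum_(0 <= k <oo) (p k * k.+1%:R ^+ L)%:E < +oo)%E.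
Proof.
have pL : (\sum_(0 <= k <oo) (k%:R ^+ L * p k)%:E < +oo)%E.
  by rewrite /L; case: (leqP 1 l) => [l1|]; rewrite ?(maxn_idPr l1)//;
    case: l hmom => // _ _; exact: hmean.
apply: (@le_lt_trans _ _ ((2 ^+ L)%:E *
    (\sum_(0 <= k <oo) (k%:R ^+ L * p k)%:E + \sum_(0 <= k <oo) (p k)%:E))%E).
  rewrite -nneseriesD; last 2 first.
  - by move=> k _ _; rewrite lee_fin mulr_ge0// exprn_ge0.
  - by move=> k _ _; rewrite lee_fin.
  rewrite -nneseriesZl; last by move=> k _; rewrite -EFinD lee_fin addr_ge0// mulr_ge0// exprn_ge0.
  apply: lee_nneseries => [k _ _|k _]; first by rewrite lee_fin mulr_ge0// exprn_ge0.
  rewrite -EFinD -EFinM lee_fin -[X in _ + X]mul1r -mulrDl mulrA mulrC ler_wpM2r//.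
  have L2 : 1 <= 2 ^+ L :> R by rewrite exprn_ege1// ler1n.
  case: k => [|k]; first by rewrite expr1n mulr_ege1// lerDr exprn_ge0.
  apply: (@le_trans _ _ (2 ^+ L * k.+1%:R ^+ L)).
    by rewrite -exprMn lerXn2r ?nnegrE// ?mulr_ge0// -natrM ler_nat; lia.
  by rewrite ler_wpM2l ?exprn_ge0// lerDl.
have s1 : (\sum_(0 <= k <oo) (p k)%:E = 1)%E by exact: hp.2.
rewrite s1; apply: lte_mul_pinfty; rewrite ?lee_fin ?exprn_ge0//.
by rewrite lte_add_pinfty// ltry.
Qed.

Let g k := s * q k + 1 - q k.

Let g01 k : 0 <= g k <= 1.
Proof.
have /andP[q0 q1] := hq k; rewrite /g; apply/andP; split.
  by rewrite -addrA addr_ge0 ?mulr_ge0// subr_ge0.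
suff : s * q k <= q k by lra.
by rewrite ler_piMl.
Qed.

Let aE k : a k = p k * g k. Proof. by []. Qed.

Lemma alpha_le k : 0 <= a k <= p k.
Proof. by have /andP[g0 g1] := g01 k; rewrite aE mulr_ge0//= ler_piMr. Qed.

Lemma alpha_moment : (\sum_(0 <= k <oo) (a k * k.+1%:R ^+ L)%:E < +oo)%E.
Proof.
apply: le_lt_trans offspring_moment; apply: lee_nneseries => [k _ _|k _];
  have /andP[a0 ap] := alpha_le k.
  by rewrite lee_fin mulr_ge0// exprn_ge0.
by rewrite lee_fin ler_wpM2r// exprn_ge0.
Qed.

(** At an index k0 with p(k0)q(k0) > 0, the total mass 1 loses at least p(k0)q(k0)(1 - s). *)
Lemma alpha_gf1_lt1 : gf a 1 < 1.
Proof.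
have [k0 pq0] := hpq; have tame1 := @tame_cst R L 1 ler01.
have tg : tame L g by exact: (tame_le g01 tame1).
have gf1E : gf a 1 = wsum p g.
  congr fine; apply: eq_eseriesr => k _; by rewrite expr1n mulr1 aE.
have p1E : wsum p (fun=> 1) = 1.
  rewrite /wsum; under eq_eseriesr do rewrite mulr1.
  by rewrite hp.2.
pose d k := 1 - g k.
have td : tame L d.
  by apply: (tame_le _ tame1) => k; have /andP[g0 g1] := g01 k; rewrite /d subr_ge0 g1 gerBl.
have ts := tame_single k0 td.
have : wsum p g + p k0 * d k0 <= 1.
  rewrite -p1E -(wsum_single p_ge0 offspring_moment k0 td).
  rewrite -(wsumD p_ge0 offspring_moment tg ts).
  apply: (le_wsum p_ge0 offspring_moment) => //; first exact: tameD.
  move=> k _; have /andP[g0 g1] := g01 k.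
  by case: eqP => [->|_]; rewrite /d ?addr0// addrC subrK.
have : 0 < p k0 * d k0.
  have -> : p k0 * d k0 = (p k0 * q k0) * (1 - s) by rewrite /d /g; ring.
  by rewrite mulr_gt0// subr_gt0; case/andP: hs.
by rewrite gf1E; lra.
Qed.

End setup.

Section limits.
Context {R : realType}.
Variables (p q : nat -> R) (l : nat) (P : probability mtreeF R) (s : R).
Hypotheses (hp : offspring_distribution p) (hp01 : p 0%N + p 1%N < 1)
  (hmean : has_moment p 1) (hmom : has_moment p l) (hq : mark_function q)
  (hpq : exists k, 0 < p k * q k) (hP : marked_GW p q P) (hs : 0 < s < 1).

Let L := maxn 1 l.
Let a k := alpha p q k s.
Let s_gt0 : 0 < s. Proof. by case/andP: hs. Qed.
Let s_le1 : s <= 1. Proof. by case/andP: hs => _ /ltW. Qed.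
Let a_ge0 k : 0 <= a k. Proof. exact: alpha_ge0. Qed.
Let am := alpha_moment hp hmean hmom hq hs.
Let gf1 : gf a 1 < 1. Proof. exact: alpha_gf1_lt1 hmean hmom hq hpq hs. Qed.
Let L_gt0 : (0 < L)%N. Proof. exact: leq_maxl. Qed.
Let lL : (l <= L)%N. Proof. exact: leq_maxr. Qed.

Lemma alpha_gt0 k : 0 < p k -> 0 < a k.
Proof.
move=> pk; have /andP[q0 q1] := hq k; rewrite /a /alpha mulr_gt0//.
have [->|qk] := eqVneq (q k) 0; first by rewrite mulr0 add0r subr0.
by rewrite -addrA ltr_pwDl ?subr_ge0// mulr_gt0// lt_neqAle eq_sym qk.
Qed.

Lemma alpha_branching : exists2 k, (2 <= k)%N & 0 < a k.
Proof.
have [[k k2 pk]|h] := pselect (exists2 k, (2 <= k)%N & 0 < p k).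
  by exists k => //; exact: alpha_gt0.
have p0 k : (2 <= k)%N -> p k = 0.
  move=> k2; apply/eqP; rewrite eq_le (hp.1 k) andbT leNgt; apply/negP => pk.
  by apply: h; exists k.
have := hp.2; rewrite (@nneseries_split _ _ 0%N 2); last by move=> k _; rewrite lee_fin hp.1.
rewrite eseries0; last by move=> k k2 _; rewrite p0.
rewrite adde0 add0n big_nat_recr//= big_nat1 -EFinD => -[] /eqP.
by rewrite lt_eqF.
Qed.

(** The youngest generation is averaged out first, which turns X into f(X); hence the iterate is
    unfolded from the inside. *)
Lemma integral_branching n m (D : set mtreeF) (X : {poly R}) j :
  Fn n D -> jet X -> (j <= L)%N ->
  (\int[P]_(x in D) ((s ^+ Mn (n + m) x)%:E * ((X ^+ Zn (n + m) x)`_j)%:E) =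
   \int[P]_(x in D) ((s ^+ Mn n x)%:E *
     ((iter m (fpol a L) X ^+ Zn n x)`_j)%:E))%E.
Proof.
move=> FD jX jL; elim: m X jX => [|m IH] X jX; first by rewrite addn0.
rewrite addnS (@integral_one_step _ _ _ _ _ hp hq hP hs _ _ (fun k => ((X ^+ k)`_j)%:E)).
- rewrite iterSr -IH; last exact: (jet_fpol a_ge0 am).
  apply: eq_integral => x _; congr (_ * _)%E.
  by rewrite (iter_offspring_op_coef a_ge0 am)// expr0 mul1r.
- exact: Fn_le (leq_addr _ _) FD.
- by move=> k; rewrite lee_fin; apply: coef_exp_ge0; exact: jX.1.
Qed.

Lemma Ex_restrict (D : set mtreeF) (g : mtreeF -> R) : measurable D ->
  Ex P (fun x => \1_D x * g x) = fine (\int[P]_(x in D) (g x)%:E)%E.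
Proof.
move=> mD; rewrite /Ex unlock [in RHS]integral_mkcond; congr fine.
apply: eq_integral => x _; rewrite patchE indicE.
by case: ifPn => [xD|/negbTE xD]; rewrite ?mul1r ?mul0r.
Qed.

Definition level_mean n (D : set mtreeF) (V : nat -> R) : R :=
  fine (\int[P]_(x in D) (s ^+ Mn n x * V (Zn n x))%:E)%E.

Lemma Ex_level_mean n (D : set mtreeF) V : Fn n D ->
  Ex P (fun x => \1_D x * (s ^+ Mn n x * V (Zn n x))) = level_mean n D V.
Proof. by move=> FD; rewrite Ex_restrict//; exact: measurable_Fn FD. Qed.

Let measurable_level n (D : set mtreeF) (V : nat -> R) : Fn n D ->
  measurable_fun D (fun x : mtreeF => (s ^+ Mn n x * V (Zn n x))%:E).
Proof.
move=> FD; apply: (@measurable_fun_restr n); first exact: measurable_Fn FD.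
by move=> x y e; rewrite (restr_Mn e) (restr_Zn e).
Qed.

(** No integrability is asked: a positive c keeps an infinite integral infinite, and [fine] then
    makes both sides 0. *)
Lemma level_meanZ n (D : set mtreeF) c V : Fn n D -> 0 < c -> (forall k, 0 <= V k) ->
  level_mean n D (fun k => c * V k) = c * level_mean n D V.
Proof.
move=> FD c0 V0; rewrite /level_mean.
have -> : (\int[P]_(x in D) (s ^+ Mn n x * (c * V (Zn n x)))%:E =
   c%:E * \int[P]_(x in D) (s ^+ Mn n x * V (Zn n x))%:E)%E.
  rewrite -ge0_integralZl_EFin ?(ltW c0)//.
  - by apply: eq_integral => x _; rewrite -EFinM mulrCA.
  - exact: measurable_Fn FD.
  - by move=> x _; rewrite lee_fin mulr_ge0// exprn_ge0// ltW.
  - exact: measurable_level.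
case: (integral _ _ _) => [x| |] //.
  by rewrite gt0_muley ?lte_fin//= mulr0.
by rewrite gt0_muleNy ?lte_fin//= mulr0.
Qed.

Lemma Fn_setT n : Fn n setT.
Proof. by exists setT => //; rewrite setTI preimage_setT. Qed.

Lemma level_mean_jets t n m (D : set mtreeF) : Fn n D -> 0 <= t <= 1 ->
  Ex P (fun x => \1_D x *
    ((hilbert R l).[(Zn (n + m) x)%:R] * s ^+ Mn (n + m) x * t ^+ Zn (n + m) x)) =
  level_mean n D (fun k => (jets a L t m ^+ k)`_l).
Proof.
move=> FD t01; rewrite Ex_restrict; last exact: measurable_Fn FD.
rewrite /level_mean; congr fine.
transitivity (\int[P]_(x in D) ((s ^+ Mn (n + m) x)%:E * ((jet0 t ^+ Zn (n + m) x)`_l)%:E))%E.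
  by apply: eq_integral => x _; rewrite mulrAC hilbert_jet0 -EFinM mulrC.
by rewrite (integral_branching _ FD (jet_jet0 t01) lL).
Qed.

Lemma GW_ratioE t n m (Lambda : set mtreeF) : Fn n Lambda -> 0 <= t <= 1 ->
  GW_ratio P l s t n Lambda m =
  level_mean n Lambda (fun k => (jets a L t m ^+ k)`_l) /
  level_mean n setT (fun k => (jets a L t m ^+ k)`_l).
Proof.
move=> FL t01; rewrite /GW_ratio level_mean_jets//; congr (_ / _).
rewrite -(level_mean_jets _ (Fn_setT n) t01); congr (Ex P _).
by apply/funext => x; rewrite indicT mul1r.
Qed.

Lemma level_mean_cvg n (D : set mtreeF) (N : nat) (V : nat -> nat -> R) (v : nat -> R) :
  Fn n D -> {ae P, forall x : mtreeF, (N <= Zn n x)%N} ->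
  (exists C, \forall m \near \oo, forall k, (N <= k)%N -> 0 <= V m k <= C) ->
  (forall k, (N <= k)%N -> V m k @[m --> \oo] --> v k) ->
  level_mean n D (V m) @[m --> \oo] --> level_mean n D v.
Proof.
move=> FD hN [C [m0 _ hC]] hV; have mD := measurable_Fn FD.
(* Dominated convergence wants the bound at every index, so the first m0 are dropped. *)
rewrite -(cvg_shiftn m0).
have [] := @dominated_convergence _ _ _ P D mD
  (fun m x => (s ^+ Mn n x * V (m + m0)%N (Zn n x))%:E)
  (fun x => (s ^+ Mn n x * v (Zn n x))%:E) (EFin \o cst C).
- by move=> m; exact: measurable_level.
- exact: measurable_level.
- apply: filterS hN => x Nx _; apply: cvg_EFin; first exact: nearW.
  apply: cvgM; first exact: cvg_cst.
  by rewrite (cvg_shiftn m0 (fun m => V m (Zn n x))); exact: hV.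
- exact: finite_measure_integrable_cst.
- apply: filterS hN => x Nx m Dx; have /andP[V0 VC] := hC (m + m0)%N (leq_addl _ _) _ Nx.
  rewrite /= lee_fin ger0_norm; last by rewrite mulr_ge0// exprn_ge0// ltW.
  apply: le_trans VC; rewrite ler_piMl// exprn_ile1// ltW//.
move=> iv _ cv; apply: fine_cvg; rewrite /level_mean fineK//.
exact: integrable_fin_num.
Qed.

Lemma GW_ratio_cvg t n (Lambda : set mtreeF) (norm : nat -> R) N v :
  Fn n Lambda -> 0 <= t <= 1 -> {ae P, forall x : mtreeF, (N <= Zn n x)%N} ->
  (exists C, \forall m \near \oo, 0 < norm m /\
    forall k, (N <= k)%N -> (jets a L t m ^+ k)`_l / norm m <= C) ->
  (forall k, (N <= k)%N ->
    (jets a L t m ^+ k)`_l / norm m @[m --> \oo] --> v k) ->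
  level_mean n setT v != 0 ->
  GW_ratio P l s t n Lambda m @[m --> \oo] -->
  level_mean n Lambda v / level_mean n setT v.
Proof.
move=> FL t01 hN [C [m0 _ hC]] hV v0.
have W0 m k : 0 <= (jets a L t m ^+ k)`_l.
  apply: coef_exp_ge0; apply: (jet_iter_fpol a_ge0 am gf1 _ _).1.
  exact: jet_jet0.
pose V m k := (jets a L t m ^+ k)`_l / norm m.
have VD D : Fn n D -> level_mean n D (V m) @[m --> \oo] --> level_mean n D v.
  move=> FD; apply: (level_mean_cvg FD hN) => //.
  exists C; exists m0 => // m /hC[n0 nC] k Nk.
  by rewrite nC// andbT divr_ge0// ltW.
apply: (@cvg_trans _ ((level_mean n Lambda (V m) / level_mean n setT (V m)) @[m --> \oo])).
  apply: near_eq_cvg; exists m0 => // m /hC[n0 _].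
  rewrite GW_ratioE// /V.
  have e D : Fn n D -> level_mean n D (fun k => (jets a L t m ^+ k)`_l / norm m) =
      (norm m)^-1 * level_mean n D (fun k => (jets a L t m ^+ k)`_l).
    move=> FD; rewrite -level_meanZ ?invr_gt0//; congr level_mean.
    by apply/funext => k; rewrite mulrC.
  rewrite !e//; last exact: Fn_setT.
  by rewrite invfM invrK mulrACA mulVf ?mul1r// gt_eqF.
by apply: cvgM; [exact: VD|apply: cvgV => //; apply: VD; exact: Fn_setT].
Qed.

Let integral_cstT (c : \bar R) : (\int[P]_(y in setT) cst c y = c)%E.
Proof.
rewrite integral_cst//.
exact: etrans (congr1 (fun z => c * z)%E (probability_setT P)) (mule1 c).
Qed.

Lemma level_mean_fixed n x : 0 <= x <= 1 -> gf a x = x ->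
  level_mean n setT (fun k => x ^+ k) = x.
Proof.
move=> x01 gx; have [x0 x1] := andP x01.
have jX : jet x%:P by split; [move=> i; rewrite coefC; case: ifP|rewrite coefC].
have X0 m : (iter m (fpol a L) x%:P)`_0 = x.
  by elim: m => [|m IH]; rewrite ?coefC//= coef0_fpol IH.
rewrite /level_mean.
have := @integral_branching 0 n setT x%:P 0 (Fn_setT 0) jX isT.
rewrite add0n => h; transitivity (fine (x%:E)%E); last by [].
congr fine; transitivity (\int[P]_(y in setT) ((s ^+ Mn n y)%:E * ((x%:P ^+ Zn n y)`_0)%:E))%E.
  by apply: eq_integral => y _; rewrite coef0_exp coefC -EFinM.
rewrite h; transitivity (\int[P]_(y in setT) cst x%:E y)%E.
  by apply: eq_integral => y _; rewrite Mn0 Zn0 mul1e expr1 X0.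
exact: integral_cstT.
Qed.

(** Started from x + eps, the coefficient of index 1 is the derivative of the n-th iterate, which at
    a fixed point is f'(x)^n by the chain rule. *)
Lemma level_mean_fixed_deriv n x : 0 <= x <= 1 -> gf a x = x ->
  level_mean n setT (fun k => k%:R * x ^+ k.-1) = dgf a x ^+ n.
Proof.
move=> x01 gx; have [x0 x1] := andP x01.
pose X : {poly R} := x%:P + 'X.
have cX i : X`_i = (if i == 0%N then x else 0) + (i == 1%N)%:R.
  by rewrite /X coefD coefC coefX.
have jX : jet X.
  split; last by rewrite cX addr0.
  by move=> i; rewrite cX addr_ge0//; case: ifP.
have X0 m : (iter m (fpol a L) X)`_0 = x.
  by elim: m => [|m IH]; rewrite ?cX ?addr0//= coef0_fpol IH.
have X1 m : (iter m (fpol a L) X)`_1 = dgf a x ^+ m.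
  elim: m => [|m IH]; first by rewrite cX add0r.
  rewrite iterS (coef1_fpol a_ge0 am L_gt0) ?X0 ?IH ?exprS//.
  exact: jet_iter_fpol.
rewrite /level_mean.
have := @integral_branching 0 n setT X 1 (Fn_setT 0) jX L_gt0.
rewrite add0n => h; transitivity (fine (dgf a x ^+ n)%:E); last by [].
congr fine; transitivity (\int[P]_(y in setT) ((s ^+ Mn n y)%:E * ((X ^+ Zn n y)`_1)%:E))%E.
  by apply: eq_integral => y _; rewrite coef1_exp (X0 0%N) (X1 0%N) mulr1 -EFinM.
rewrite h; transitivity (\int[P]_(y in setT) cst (dgf a x ^+ n)%:E y)%E.
  by apply: eq_integral => y _; rewrite Mn0 Zn0 mul1e expr1 X1.
exact: integral_cstT.
Qed.

Lemma gen_fun_gf x : 0 <= x <= 1 -> gen_fun P s x = gf a x.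
Proof.
move=> x01; have [x0 x1] := andP x01.
have jX : jet x%:P by split; [move=> i; rewrite coefC; case: ifP|rewrite coefC].
have := @integral_branching 0 1 setT x%:P 0 (Fn_setT 0) jX isT.
rewrite /gen_fun /Ex unlock add0n => h; transitivity (fine (gf a x)%:E); last by [].
congr fine; transitivity (\int[P]_(y in setT) ((s ^+ Mn 1 y)%:E * ((x%:P ^+ Zn 1 y)`_0)%:E))%E.
  by apply: eq_integral => y _; rewrite coef0_exp coefC -EFinM.
rewrite h; transitivity (\int[P]_(y in setT) cst (gf a x)%:E y)%E.
  by apply: eq_integral => y _; rewrite Mn0 Zn0 mul1e expr1 /= coef0_fpol coefC.
exact: integral_cstT.
Qed.

(** * Populations of minimal size *)

Section minimal.
Variable r : nat.
Hypotheses (pr : 0 < p r) (r_min : forall k, 0 < p k -> (r <= k)%N).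

Lemma alpha_lt_min k : (k < r)%N -> a k = 0.
Proof.
move=> kr; have pk : p k = 0.
  apply/eqP; rewrite eq_le (hp.1 k) andbT leNgt; apply/negP => /r_min.
  by rewrite leqNgt kr.
by rewrite /a /alpha pk mul0r.
Qed.

Lemma iter_offspring_op_below N phi i c : (forall k, (N <= k)%N -> phi k = 0%E) ->
  (N <= c + i * r)%N -> iter i (offspring_op a) phi c = 0%E.
Proof.
move=> phi0; elim: i c => [|i IH] c; first by rewrite mul0n addn0; exact: phi0.
move=> h; rewrite iterS /offspring_op eseries0// => k _ _.
have [kr|rk] := ltnP k r; first by rewrite alpha_lt_min// mul0e.
by rewrite IH ?mule0//; lia.
Qed.

(** Starting from c, i nodes of positive weight reach at least c + i r >= N, so N is attained only
    if c + i r = N and each node has exactly r children. *)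
Lemma iter_offspring_op_eq N i c : (N <= c + i * r)%N ->
  iter i (offspring_op a) (fun k => ((k == N)%:R)%:E) c =
  (a r ^+ i * (c + i * r == N)%N%:R)%:E.
Proof.
elim: i c => [|i IH] c; first by rewrite mul0n addn0 expr0 mul1r.
move=> h; rewrite iterS /offspring_op.
have ge0 k : (0 <= (a k)%:E * iter i (offspring_op a) (fun k => ((k == N)%:R)%:E) (c + k)%N)%E.
  rewrite mule_ge0 ?lee_fin//.
  by apply: iter_offspring_op_ge0 => // j; rewrite lee_fin.
rewrite (nneseriesD1 (n := r))// eseries0.
  rewrite adde0 IH; last by lia.
  rewrite -EFinM mulrA -exprS; congr (_ * _%:R)%:E.
  by congr nat_of_bool; apply/eqP/eqP; lia.
move=> k _ /= kr; have [kr'|rk] := ltnP k r; first by rewrite alpha_lt_min// mul0e.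
rewrite IH; last by lia.
have -> : (c + k + i * r == N)%N = false by apply/eqP; move/eqP: kr; lia.
by rewrite mulr0 mule0.
Qed.

(** One branching step shows that s^M times the indicator of a smaller population has integral 0; as
    s^M > 0, the indicator vanishes almost surely. *)
Lemma Zn_ge_min n : {ae P, forall x : mtreeF, (r ^ n <= Zn n x)%N}.
Proof.
elim: n => [|n IH]; first by apply: aeW => x; rewrite Zn0.
pose phi k : \bar R := ((k < r ^ n.+1)%N%:R)%:E.
have phi0 k : (0 <= phi k)%E by rewrite lee_fin.
have sM m (x : mtree) : (0 < (s ^+ Mn m x)%:E)%E by rewrite lte_fin exprn_gt0.
have h := integral_one_step hp hq hP hs (Fn_setT n) phi0.
have mf : measurable_fun setT (fun x : mtreeF => (s ^+ Mn n.+1 x)%:E * phi (Zn n.+1 x))%E.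
  apply: (@measurable_fun_restr n.+1) => // x y e.
  by rewrite (restr_Mn e) (restr_Zn e).
have mg : measurable_fun setT (fun x : mtreeF => (s ^+ Mn n x)%:E *
    iter (Zn n x) (offspring_op a) phi 0%N)%E.
  apply: (@measurable_fun_restr n) => // x y e.
  by rewrite (restr_Mn e) (restr_Zn e).
have I0 : (\int[P]_(x in setT) `|(s ^+ Mn n.+1 x)%:E * phi (Zn n.+1 x)| = 0)%E.
  under eq_integral do rewrite (gee0_abs (mule_ge0 (ltW (sM _ _)) (phi0 _))).
  rewrite h (_ : 0%E = \int[P]_(x in setT) cst 0%E x)%E; last by rewrite integral0.
  apply: ge0_ae_eq_integral => //.
  - by move=> x _; apply: mule_ge0; [exact/ltW/sM|exact: iter_offspring_op_ge0].
  - apply: filterS IH => x nx _.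
    rewrite (@iter_offspring_op_below (r ^ n.+1)) ?mule0// => [k rk|].
      by rewrite /phi ltnNge rk.
    by rewrite add0n expnSr leq_mul2r nx orbT.
have := (ae_eq_integral_abs P measurableT mf).1 I0.
apply: filterS => x /(_ I) /eqP; rewrite mule_eq0 gt_eqF//= /phi eqe pnatr_eq0 eqb0.
by rewrite -leqNgt.
Qed.

(** Reaching r^(m+1) forces Z_m = r^m and exactly r children for each of these nodes, hence a factor
    a_r^(r^m) per generation. *)
Lemma level_mean_min n : (0 < r)%N ->
  level_mean n setT (fun k => (k == (r ^ n)%N)%:R) = a r ^+ (\sum_(i < n) r ^ i)%N.
Proof.
move=> r0; suff h m : (\int[P]_(x in setT) (s ^+ Mn m x * (Zn m x == (r ^ m)%N)%:R)%:E =
    (a r ^+ (\sum_(i < m) r ^ i)%N)%:E)%E by rewrite /level_mean h.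
elim: m => [|m IH].
  transitivity (\int[P]_(x in setT) cst 1%E x)%E.
    by apply: eq_integral => x _; rewrite Mn0 Zn0 mul1r eqxx.
  by rewrite integral_cstT big_ord0.
pose phi k : \bar R := ((k == (r ^ m.+1)%N)%:R)%:E.
have phi0 k : (0 <= phi k)%E by rewrite lee_fin.
have h := integral_one_step hp hq hP hs (Fn_setT m) phi0.
under eq_integral do rewrite EFinM.
rewrite h big_ord_recr /= addnC exprD EFinM -IH -ge0_integralZl_EFin//; last 3 first.
- by move=> x _; rewrite lee_fin mulr_ge0// exprn_ge0// ltW.
- exact: (@measurable_level m setT (fun k => (k == (r ^ m)%N)%:R) (Fn_setT m)).
- by rewrite exprn_ge0.
apply: ge0_ae_eq_integral => //.
- apply: (@measurable_fun_restr m) => // x y e.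
  by rewrite (restr_Mn e) (restr_Zn e).
- apply: (@measurable_fun_restr m) => // x y e.
  by rewrite (restr_Mn e) (restr_Zn e).
- move=> x _; apply: mule_ge0; first by rewrite lee_fin exprn_ge0// ltW.
  exact: iter_offspring_op_ge0.
- by move=> x _; rewrite lee_fin !mulr_ge0// ?exprn_ge0// ltW.
apply: filterS (Zn_ge_min m) => x rx _.
rewrite (@iter_offspring_op_eq (r ^ m.+1)); last by rewrite add0n expnSr leq_mul2r rx orbT.
rewrite -!EFinM add0n expnSr eqn_pmul2r// mulrCA.
by case: (eqVneq (Zn m x) (r ^ m)%N) => [->//|_]; rewrite !mulr0.
Qed.

End minimal.
Lemma GW_ratio_cvg_extinct0 t n (Lambda : set mtreeF) kappa : l = 0%N ->
  Fn n Lambda -> 0 <= t <= 1 -> 0 < p 0%N -> 0 <= kappa <= 1 -> gf a kappa = kappa ->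
  GW_ratio P l s t n Lambda m @[m --> \oo] -->
  level_mean n Lambda (fun k => kappa ^ (k%:Z - 1)).
Proof.
move=> l0 FL t01 p0 k01 gk; have [k0 k1] := andP k01.
(* A fixed point is at least a_0 > 0, so the power kappa^(-1) met when Z_n = 0 is a genuine
   inverse. *)
have kappa0 : 0 < kappa.
  rewrite -gk; apply: lt_le_trans (wsum_term a_ge0 am 0 (tameX L k01)).
  by rewrite expr0 mulr1 alpha_gt0.
pose v k := kappa ^ (k%:Z - 1).
have vE : v = (fun k => kappa^-1 * kappa ^+ k).
  by apply/funext => k; rewrite /v expfzDr ?gt_eqF// mulrC.
have v1 : level_mean n setT v = 1.
  rewrite vE level_meanZ ?invr_gt0//; last by move=> k; rewrite exprn_ge0.
    by rewrite level_mean_fixed// mulVf// gt_eqF.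
  exact: Fn_setT.
rewrite -[level_mean n Lambda _]divr1 -[X in _ / X]v1.
apply: (@GW_ratio_cvg t n Lambda (fun=> kappa) 0) => //.
- by apply: aeW => x.
- have jX m : jet (jets a L t m) by apply: (jet_iter_fpol a_ge0 am gf1); exact: jet_jet0.
  exists (1 / kappa); apply: nearW => m; split => // k _.
  rewrite l0 coef0_exp ler_pM2r ?invr_gt0// exprn_ile1//; [exact: (jX m).1|exact: (jX m).2].
- move=> k _; rewrite -[kappa ^ _]/(v k) vE l0.
  under eq_fun do rewrite coef0_exp mulrC.
  apply: cvgM; first exact: cvg_cst.
  apply: cvgn_expr; apply: (gf_orbit_cvg a_ge0 am L_gt0 gf1 k01 gk).
    by rewrite coef_jet0 mulr1.
  by move=> m; rewrite coef0_fpol.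
- by rewrite v1 oner_neq0.
Qed.

Lemma dgf_kappa_gt0 kappa : 0 < kappa <= 1 -> 0 < dgf a kappa.
Proof.
move=> /andP[k0 k1]; have [k k2 ak] := alpha_branching.
have k01 : 0 <= kappa <= 1 by rewrite ltW.
apply: lt_le_trans (wsum_term a_ge0 am k (tame_deriv L_gt0 k01)).
by rewrite mulr_gt0// mulr_gt0 ?exprn_gt0// ltr0n ltnW.
Qed.

Lemma GW_ratio_cvg_extinct t n (Lambda : set mtreeF) kappa : (0 < l)%N ->
  Fn n Lambda -> 0 < t <= 1 -> 0 < p 0%N -> 0 <= kappa <= 1 -> gf a kappa = kappa ->
  GW_ratio P l s t n Lambda m @[m --> \oo] -->
  level_mean n Lambda (fun k => k%:R * kappa ^ (k%:Z - 1) / derive1 (gen_fun P s) kappa ^+ n).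
Proof.
move=> l0 FL t01 p0 k01 gk; have [k0 k1] := andP k01.
have t01' : 0 <= t <= 1 by case/andP: t01 => /ltW ->.
have kappa0 : 0 < kappa.
  rewrite -gk; apply: lt_le_trans (wsum_term a_ge0 am 0 (tameX L k01)).
  by rewrite expr0 mulr1 alpha_gt0.
have d0 : 0 < dgf a kappa by apply: dgf_kappa_gt0; rewrite kappa0.
have kk : 0 < kappa < 1 by rewrite kappa0; exact: (kappa_lt1 gf1 k01 gk).
rewrite (derive1_gf a_ge0 am L_gt0 gf1 kk gen_fun_gf).
pose v k : R := k%:R * kappa ^+ k.-1.
have -> : (fun k : nat => k%:R * kappa ^ (k%:Z - 1) / dgf a kappa ^+ n) =
    (fun k => (dgf a kappa ^+ n)^-1 * v k).
  apply/funext => k; rewrite mulrC /v; congr (_ * _).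
  (* At k = 0 the integer power kappa^(-1) and the truncated one kappa^0 differ, but both are
     multiplied by 0. *)
  case: k => [|k]; first by rewrite !mul0r.
  by rewrite -addn1 PoszD addrK addn1.
rewrite level_meanZ ?invr_gt0 ?exprn_gt0//; last by move=> k; rewrite mulr_ge0// exprn_ge0.
have vn := level_mean_fixed_deriv n k01 gk.
rewrite mulrC -vn.
have [[C hC] hV] := coef_ratio_cvg a_ge0 am L_gt0 gf1 t01 alpha_branching lL
  (alpha_gt0 p0) k01 gk l0.
apply: (@GW_ratio_cvg t n Lambda (fun m => (jets a L t m)`_l) 0) => //.
- by apply: aeW => x.
- by exists C; apply: filterS hC => m [n0 nC]; split.
- by rewrite vn gt_eqF// exprn_gt0.
Qed.

Lemma GW_ratio_cvg_min t n (Lambda : set mtreeF) r : (0 < r)%N -> 0 < p r ->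
  (forall k, 0 < p k -> (r <= k)%N) -> Fn n Lambda -> 0 < t <= 1 ->
  GW_ratio P l s t n Lambda m @[m --> \oo] -->
  level_mean n Lambda (fun k => a r ^- (\sum_(i < n) r ^ i)%N * (k == (r ^ n)%N)%:R).
Proof.
move=> r0 pr rmin FL t01.
have t01' : 0 <= t <= 1 by case/andP: t01 => /ltW ->.
have ar := alpha_gt0 pr.
rewrite level_meanZ ?invr_gt0 ?exprn_gt0// mulrC -(level_mean_min pr rmin n r0).
have rn : (0 < r ^ n)%N by rewrite expn_gt0 r0.
have [[C hC] hV] := min_ratio_cvg a_ge0 am L_gt0 gf1 t01 alpha_branching lL
  r0 ar (alpha_lt_min rmin) rn.
apply: (@GW_ratio_cvg t n Lambda (fun m => (jets a L t m ^+ (r ^ n)%N)`_l) (r ^ n)%N) => //.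
- exact: Zn_ge_min.
- by exists C.
- by rewrite level_mean_min// gt_eqF// exprn_gt0.
Qed.

End limits.

Lemma indic_fiber (R : realType) (T : Type) (f : T -> nat) N x :
  \1_[set y | f y = N] x = (f x == N)%:R :> R.
Proof. by rewrite indicE; congr ((nat_of_bool _)%:R); apply/idP/eqP; rewrite inE. Qed.


(** In the first case t = 0 is paired with l = 0: for l > 0, H_l(0) = 0 and 0^Z = 0 for Z > 0, so at
    t = 0 numerator and denominator both vanish identically. The exponent Z_n - 1 is an integer
    because Z_n may be 0. *)
Theorem theorem1p3 (R : realType) (l : nat) (p q : nat -> R)
    (hp : offspring_distribution p) (hp01 : p 0%N + p 1%N < 1)
    (hmean : has_moment p 1) (hmom : has_moment p l)
    (hq : mark_function q) (hpq : exists k, 0 < p k * q k)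
    (P : probability mtreeF R) (hP : marked_GW p q P)
    (r : nat) (hr : 0 < p r) (hrmin : forall k, 0 < p k -> (r <= k)%N)
    (s : R) (hs : 0 < s < 1)
    (kappa : R) (hkappa01 : 0 <= kappa <= 1) (hkappa : gen_fun P s kappa = kappa)
    (n : nat) (Lambda : set mtree) (hLambda : Fn n Lambda) :
  [/\ r = 0%N -> forall t : R, 0 <= t <= 1 -> (l = 0%N \/ 0 < t) ->
        GW_ratio P l s t n Lambda m @[m --> \oo] -->
        if l == 0%N then
          Ex P (fun x => \1_Lambda x *
            (s ^+ Mn n x * kappa ^ ((Zn n x)%:Z - 1)))
        else
          Ex P (fun x => \1_Lambda x *
            (s ^+ Mn n x * (Zn n x)%:R * kappa ^ ((Zn n x)%:Z - 1)
             / (derive1 (gen_fun P s) kappa) ^+ n)),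
      r = 1%N -> forall t : R, 0 < t <= 1 ->
        GW_ratio P l s t n Lambda m @[m --> \oo] -->
        Ex P (fun x => \1_Lambda x *
          (s ^+ Mn n x * alpha p q 1 s ^- n * \1_[set y | Zn n y = 1%N] x)) &
      (2 <= r)%N -> forall t : R, 0 < t <= 1 ->
        GW_ratio P l s t n Lambda m @[m --> \oo] -->
        Ex P (fun x => \1_Lambda x *
          (s ^+ Mn n x * alpha p q r s ^- ((r ^ n - 1) %/ (r - 1))
           * \1_[set y | Zn n y = (r ^ n)%N] x))].
Proof.
have FL := hLambda.
split=> [r0 t t01 lt0|r1 t t01|r2 t t01].
- have p0 : 0 < p 0%N by rewrite -r0.
  have gk : gf (fun k => alpha p q k s) kappa = kappa.
    by rewrite -(gen_fun_gf hp hmean hmom hq hpq hP hs hkappa01).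
  case: eqP => [l0|l0].
    rewrite (Ex_level_mean P s (fun k => kappa ^ (k%:Z - 1)) FL).
    exact: (GW_ratio_cvg_extinct0 hp hmean hmom hq hpq hP hs).
  have l1 : (0 < l)%N by rewrite lt0n; apply/eqP.
  have t1 : 0 < t <= 1 by case: lt0 => // ->; case/andP: t01.
  have := GW_ratio_cvg_extinct hp hp01 hmean hmom hq hpq hP hs l1 FL t1 p0 hkappa01 gk.
  rewrite -Ex_level_mean//; congr (_ --> Ex P _); apply/funext => x.
  by rewrite !mulrA.
- have pr : 0 < p 1%N by rewrite -r1.
  have rmin k : 0 < p k -> (1 <= k)%N by rewrite -r1; exact: hrmin.
  have := GW_ratio_cvg_min hp hp01 hmean hmom hq hpq hP hs (ltn0Sn 0) pr rmin FL t01.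
  rewrite -Ex_level_mean//; congr (_ --> Ex P _); apply/funext => x.
  rewrite indic_fiber exp1n (eq_bigr (fun=> 1%N)) ?sum1_card ?card_ord ?mulrA//.
  by move=> i _; rewrite exp1n.
- have := GW_ratio_cvg_min hp hp01 hmean hmom hq hpq hP hs (ltnW r2) hr hrmin FL t01.
  rewrite -Ex_level_mean//; congr (_ --> Ex P _); apply/funext => x.
  (* The division is exact: it is the geometric sum counting the nodes of the r-ary tree below level
     n. *)
  have -> : ((r ^ n - 1) %/ (r - 1) = \sum_(i < n) r ^ i)%N.
    by rewrite !subn1 predn_exp mulKn// -ltnS prednK// ltnW.
  by rewrite indic_fiber !mulrA.
Qed.
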